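(* Let $F\colon S(n)\to\mathbb{R}$ be uniformly elliptic, and let $u$ be a viscosity supersolution and $v$ a viscosity subsolution of $F(\mathcal{H}w)=0$ in a connected nonempty open subset $\Omega\subseteq\mathbb{R}^n$. If $u\geq v$ in $\Omega$ and $u(x_0)=v(x_0)$ at some point $x_0\in\Omega$, then $u\equiv v$ in $\Omega$.
   Context: Here $n\geq 2$ and $S(n)$ is the space of symmetric real $n\times n$ matrices, partially ordered by $X\leq Y$ iff $\xi^TX\xi\leq\xi^TY\xi$ for all $\xi\in\mathbb{R}^n$; $\mathcal{H}w$ is the Hessian matrix of $w$. $F$ is uniformly elliptic if there are constants $0<\lambda\leq\Lambda$ such that $\lambda\operatorname{tr}A\leq F(X+A)-F(X)\leq\Lambda\operatorname{tr}A$ for all $X,A\in S(n)$ with $A\geq 0$ (no sublinearity of $F$ is assumed). A viscosity supersolution of $F(\mathcal{H}w)=0$ in $\Omega$ is a function $u\colon\Omega\to(-\infty,\infty]$ that is lower semicontinuous, finite on a dense subset of $\Omega$, and such that whenever $x_0\in\Omega$ and a $C^2$ function $\phi$ satisfies $\phi(x_0)=u(x_0)$ and $\phi\leq u$ near $x_0$, then $F(\mathcal{H}\phi(x_0))\leq 0$. A viscosity subsolution is a function $v\colon\Omega\to[-\infty,\infty)$ that is upper semicontinuous, finite on a dense subset of $\Omega$, and such that whenever $x_0\in\Omega$ and a $C^2$ function $\phi$ satisfies $\phi(x_0)=v(x_0)$ and $\phi\geq v$ near $x_0$, then $F(\mathcal{H}\phi(x_0))\geq 0$. *)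

(* Defs.v *)
From mathcomp Require Import all_boot all_order all_algebra.
From mathcomp Require Import all_classical all_reals all_analysis.
Set Implicit Arguments.
Unset Strict Implicit.
Unset Printing Implicit Defensive.
Import Order.TTheory GRing.Theory Num.Theory.
Import numFieldNormedType.Exports.
Local Open Scope classical_set_scope.
Local Open Scope ring_scope.

(* Points of R^n are row vectors. *)

Definition lemx (R : realType) (n : nat) (X Y : 'M[R]_n) : Prop :=
  forall xi : 'cV[R]_n,
    (xi^T *m X *m xi) ord0 ord0 <= (xi^T *m Y *m xi) ord0 ord0.

(* An operator S(n) -> R is encoded as a function on all square matrices;
   only its values on symmetric matrices are constrained. *)
Definition uniformly_elliptic (R : realType) (n : nat) (F : 'M[R]_n -> R) :
    Prop :=
  exists lam Lam : R, [/\ 0 < lam, lam <= Lam &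
    forall X A : 'M[R]_n, X \is symmetricmx -> A \is symmetricmx -> lemx 0 A ->
      lam * \tr A <= F (X + A) - F X <= Lam * \tr A].

Definition partial_derive (R : realType) (n : nat) (i : 'I_n)
    (phi : 'rV[R]_n -> R) : 'rV[R]_n -> R :=
  fun x => 'D_(delta_mx ord0 i) phi x.

Definition hessian (R : realType) (n : nat) (phi : 'rV[R]_n -> R)
    (x : 'rV[R]_n) : 'M[R]_n :=
  \matrix_(i, j) partial_derive j (partial_derive i phi) x.

(* C^2 on a neighbourhood of x0: the first and second partial derivatives
   exist and are continuous there.  Continuity of phi itself follows, and
   so does the symmetry of its Hessian matrix. *)
Definition C2_near (R : realType) (n : nat) (x0 : 'rV[R]_n)
    (phi : 'rV[R]_n -> R) : Prop :=
  \forall x \near x0, forall i j : 'I_n,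
    [/\ derivable phi x (delta_mx ord0 i),
        {for x, continuous (partial_derive i phi)},
        derivable (partial_derive i phi) x (delta_mx ord0 j) &
        {for x, continuous (partial_derive j (partial_derive i phi))}].

Definition upper_semicontinuous (X : topologicalType) (R : numFieldType)
    (f : X -> \bar R) : Prop :=
  forall x a, (f x < a%:E)%E ->
    exists2 V, nbhs x V & forall y, V y -> (f y < a%:E)%E.

(* Functions on Omega are total functions of which only the values on Omega
   matter; semicontinuity is that of the restriction to Omega, points outside
   Omega being isolated in [subspace Omega].  In the two definitions below,
   Omega is meant to be open. *)
Definition viscosity_supersolution (R : realType) (n : nat)
    (F : 'M[R]_n -> R) (Omega : set 'rV[R]_n) (u : 'rV[R]_n -> \bar R) : Prop :=
  [/\ forall x, Omega x -> (-oo < u x)%E,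
      @lower_semicontinuous (subspace Omega) R u,
      Omega `<=` closure (Omega `&` [set x | u x \is a fin_num]) &
      forall (x0 : 'rV[R]_n) (phi : 'rV[R]_n -> R),
        Omega x0 -> C2_near x0 phi -> (phi x0)%:E = u x0 ->
        (\forall x \near x0, ((phi x)%:E <= u x)%E) ->
        F (hessian phi x0) <= 0].

Definition viscosity_subsolution (R : realType) (n : nat)
    (F : 'M[R]_n -> R) (Omega : set 'rV[R]_n) (v : 'rV[R]_n -> \bar R) : Prop :=
  [/\ forall x, Omega x -> (v x < +oo)%E,
      @upper_semicontinuous (subspace Omega) R v,
      Omega `<=` closure (Omega `&` [set x | v x \is a fin_num]) &
      forall (x0 : 'rV[R]_n) (phi : 'rV[R]_n -> R),
        Omega x0 -> C2_near x0 phi -> (phi x0)%:E = v x0 ->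
        (\forall x \near x0, (v x <= (phi x)%:E)%E) ->
        0 <= F (hessian phi x0)].

(* Main.v *)
(** Set Z = {u = v}.  If Z is not open, a ball contained in {u > v} touches Z
    at some b; with nu the vector from b to its centre,
    h(y) = nu.y + C (nu.y)^2 - |y|^2 (y = x - b) satisfies
    F(X + k D^2h) >= F(X) + k theta, and h < 0 at the points y <> 0 near b which
    do not lie in the ball.  So, for small k, u - k h lies above v on a small
    sphere about b and meets it at b.

    To contradict this, let u_c and v^c be the inf- and sup-convolutions of
    u - k h and v on the closed ball, and w the function lying between them
    obtained from v by a sup- followed by an inf-convolution; w has bounded
    second differences.  For every small slope p let x_p minimise u_c - v^c - p.x;
    up to an affine function w is then squeezed between v^c and u_c, which meet
    at x_p.  Semiconcavity makes p |-> x_p expansive, so the x_p occupy a fixed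
    proportion of the cells of every grid.

    No Alexandrov theorem is needed: the mixed second differences of w at scale
    2r are averages of those at scale r, so their mean squares over a grid are
    bounded and monotone, and at some scale r they are almost constant around
    most grid points.  Hence near some x_p, w is within gamma r^2 of a quadratic
    polynomial q on a ball of radius comparable to r, with gamma arbitrarily
    small.  Bending q by K|x - x_p|^2 with K small, it touches v^c from above
    and u_c from below at nearby points, hence so do its translates for v and
    u - k h.  This gives F(D^2q + K) >= 0 and F(D^2q - K + k D^2h) <= 0, against
    the gain k theta. *)

Require Import Defs.
From mathcomp Require Import all_boot all_order all_algebra.
From mathcomp Require Import all_classical all_reals all_analysis.
From mathcomp Require Import ring lra zify.
Import Order.TTheory GRing.Theory Num.Theory.
Import numFieldNormedType.Exports.
Set Implicit Arguments.
Unset Strict Implicit.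
Unset Printing Implicit Defensive.
Local Open Scope classical_set_scope.
Local Open Scope ring_scope.

Lemma sqr_le_norm (R : realDomainType) (x y : R) :
  `|x| <= y -> x ^+ 2 <= y ^+ 2.
Proof.
move=> h; rewrite -(real_normK (num_real x)) lerXn2r// nnegrE.
exact: le_trans h.
Qed.

(** * Inner product and finite differences *)

Section Dot.
Variables (R : realType) (n : nat).
Implicit Types (x y z : 'rV[R]_n) (H : 'M[R]_n).

Definition dot x y : R := \sum_i x 0 i * y 0 i.

Lemma dotC x y : dot x y = dot y x.
Proof. by apply: eq_bigr => i _; rewrite mulrC. Qed.

Lemma dotDl x y z : dot (x + y) z = dot x z + dot y z.
Proof. by rewrite /dot -big_split; apply: eq_bigr => i _; rewrite mxE mulrDl. Qed.

Lemma dotDr x y z : dot z (x + y) = dot z x + dot z y.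
Proof. by rewrite dotC dotDl !(dotC z). Qed.

Lemma dotZl a x y : dot (a *: x) y = a * dot x y.
Proof. by rewrite /dot mulr_sumr; apply: eq_bigr => i _; rewrite mxE mulrA. Qed.

Lemma dotZr a x y : dot x (a *: y) = a * dot x y.
Proof. by rewrite dotC dotZl dotC. Qed.

Lemma dotNl x y : dot (- x) y = - dot x y.
Proof. by rewrite -scaleN1r dotZl mulN1r. Qed.

Lemma dotNr x y : dot x (- y) = - dot x y.
Proof. by rewrite dotC dotNl dotC. Qed.

Lemma dot0l x : dot 0 x = 0.
Proof. by rewrite -(scale0r 0) dotZl mul0r. Qed.

Lemma dot0r x : dot x 0 = 0.
Proof. by rewrite dotC dot0l. Qed.

Definition dotE := (dotDl, dotDr, dotNl, dotNr, dotZl, dotZr, dot0l, dot0r).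

Lemma dot_ge0 x : 0 <= dot x x.
Proof. by apply: sumr_ge0 => i _; rewrite -expr2 sqr_ge0. Qed.

Lemma dot_delta x i : dot x (delta_mx 0 i) = x 0 i.
Proof.
rewrite /dot (bigD1 i)//= mxE !eqxx mulr1 big1 ?addr0// => j ji.
by rewrite mxE (negPf ji) andbF mulr0.
Qed.

Lemma coord_le_dot x i : x 0 i ^+ 2 <= dot x x.
Proof.
rewrite /dot (bigD1 i)//= -expr2 lerDl; apply: sumr_ge0 => j _.
by rewrite -expr2 sqr_ge0.
Qed.

Lemma dot_le_coord x r : 0 <= r -> (forall i, `|x 0 i| <= r) ->
  dot x x <= n%:R * r ^+ 2.
Proof.
move=> r0 xr; apply: (@le_trans _ _ (\sum_(i < n) r ^+ 2)).
  by apply: ler_sum => i _; rewrite -expr2 -real_normK ?num_real// lerXn2r// nnegrE.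
by rewrite sumr_const card_ord mulr_natl.
Qed.

Lemma dot_young (a : R) x y : 0 < a ->
  dot x y <= a * dot x x + (4 * a)^-1 * dot y y.
Proof.
move=> a0; have := dot_ge0 ((2 * a) *: x - y); rewrite !dotE (dotC y x) => h.
have -> : a * dot x x + (4 * a)^-1 * dot y y =
  dot x y + (4 * a)^-1 * (2 * a * (2 * a * dot x x) - 2 * a * dot x y -
   (2 * a * dot x y - dot y y)).
  by field; rewrite gt_eqF.
rewrite lerDl mulr_ge0//; first by rewrite invr_ge0; lra.
by apply: le_trans h _; lra.
Qed.

Lemma symmetricmxP H : reflect (H^T = H) (H \is symmetricmx).
Proof.
apply: (iffP idP) => [/is_hermitianmxP|HH].
  by rewrite expr0 scale1r map_mx_id.
by apply/is_hermitianmxP; rewrite expr0 scale1r map_mx_id.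
Qed.

Lemma mulmx_dot_sym H x y : H^T = H -> dot (x *m H) y = dot (y *m H) x.
Proof.
move=> sH; rewrite /dot.
under eq_bigr do rewrite mxE big_distrl/=.
under [RHS]eq_bigr do rewrite mxE big_distrl/=.
rewrite exchange_big; apply: eq_bigr => i _; apply: eq_bigr => j _.
by rewrite -[in LHS]sH mxE; ring.
Qed.

End Dot.

Section Differences.
Variables (R : realType) (n : nat).
Notation E := 'rV[R]_n.
Implicit Types (f w : E -> R) (x a : E).

Definition fd a f : E -> R := fun x => f (x + a) - f x.

Lemma fdC a b f x : fd a (fd b f) x = fd b (fd a f) x.
Proof. by rewrite /fd (addrAC x b a); ring. Qed.

Lemma fd_double a b f x :
  fd (a + a) (fd (b + b) f) x =
  fd a (fd b f) x + fd a (fd b f) (x + b) +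
  fd a (fd b f) (x + a) + fd a (fd b f) (x + a + b).
Proof. by rewrite /fd !addrA !(addrAC _ b a); ring. Qed.

(** Dividing by [4 ^+ k] makes the scales comparable: each of these quotients is the average of four
    quotients at the previous scale. *)
Definition dyadic_fd f a b (k : nat) : E -> R :=
  fun x => fd (2 ^+ k *: a) (fd (2 ^+ k *: b) f) x / 4 ^+ k.

Lemma dyadic_fdS f a b k x : let M := dyadic_fd f a b k in
  dyadic_fd f a b k.+1 x =
  (M x + M (x + 2 ^+ k *: b) + M (x + 2 ^+ k *: a) +
   M (x + 2 ^+ k *: a + 2 ^+ k *: b)) / 4.
Proof.
rewrite /dyadic_fd /=.
have d (c : E) : 2 ^+ k.+1 *: c = 2 ^+ k *: c + 2 ^+ k *: c.
  by rewrite -scalerDl exprS; congr (_ *: _); ring.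
rewrite !d fd_double exprS; field.
by rewrite expf_neq0.
Qed.

(** The mean of the squares minus the square of the mean is the variance of the four numbers, and
    the pair [p], [q] alone contributes at least [(p - q) ^+ 2 / 8] to it. *)
Lemma sqr_avg4 (p q r s : R) :
  (p - q) ^+ 2 / 8 + ((p + q + r + s) / 4) ^+ 2 <=
  (p ^+ 2 + q ^+ 2 + r ^+ 2 + s ^+ 2) / 4.
Proof.
rewrite -subr_ge0.
have -> : (p ^+ 2 + q ^+ 2 + r ^+ 2 + s ^+ 2) / 4 -
  ((p - q) ^+ 2 / 8 + ((p + q + r + s) / 4) ^+ 2) =
  ((p + q - 2 * r) ^+ 2 / 2 + (p + q - 2 * s) ^+ 2 / 2 + (r - s) ^+ 2) / 16.
  by field.
by rewrite divr_ge0// !addr_ge0 ?divr_ge0 ?sqr_ge0.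
Qed.

(** Equivalently, [w + C |x|^2] is convex and [w - C |x|^2] is concave. *)
Definition two_sided C w := forall x y (s : R), 0 <= s <= 1 ->
  `|w (s *: x + (1 - s) *: y) - s * w x - (1 - s) * w y| <=
  C * (s * (1 - s)) * dot (x - y) (x - y).

(** The diagonals of a parallelogram share their midpoint; [two_sided] is applied to both with
    [s = 1/2], and the parallelogram law adds up the errors. *)
Lemma two_sided_fd C w a b x : two_sided C w ->
  `|fd a (fd b w) x| <= C * (dot a a + dot b b).
Proof.
move=> ts; rewrite /fd.
have hs : 0 <= (2^-1 : R) <= 1 by apply/andP; split; lra.
have := ts (x + a + b) x _ hs; have := ts (x + a) (x + b) _ hs.
have e2 : (1 - 2^-1 : R) = 2^-1 by field.
rewrite e2 -!scalerDr.
have -> : x + a + (x + b) = x + a + b + x by rewrite addrA (addrAC _ x b).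
have -> : x + a - (x + b) = a - b by rewrite opprD addrACA subrr add0r.
have -> : x + a + b - x = a + b by rewrite -(addrA x) (addrC x) addrK.
set p := w (2^-1 *: _); rewrite !dotE (dotC b a).
rewrite !ler_norml => /andP[h1 h2] /andP[h3 h4].
by apply/andP; split; lra.
Qed.

Section Box.
Variables (o : E) (eta : R).

Definition latt (z : 'I_n -> nat) : E := o + eta *: \row_i (z i)%:R.

Definition box_sum b (g : E -> R) : R :=
  \sum_(z : {ffun 'I_n -> 'I_b}) g (latt (fun i => z i)).

Lemma latt_shift (z s : 'I_n -> nat) :
  latt z + eta *: \row_i (s i)%:R = latt (fun i => z i + s i)%N.
Proof.
rewrite /latt -addrA -scalerDr; congr (_ + _ *: _).
by apply/rowP => i; rewrite !mxE natrD.
Qed.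

Lemma box_sum_shift b d (s : 'I_n -> nat) g : (forall x, 0 <= g x) ->
  (forall i, s i <= d)%N ->
  box_sum b (fun x => g (x + eta *: \row_i (s i)%:R)) <= box_sum (b + d) g.
Proof.
move=> g0 sd; rewrite /box_sum.
have lt i (z : {ffun 'I_n -> 'I_b}) : (z i + s i < b + d)%N.
  by have := ltn_ord (z i); have := sd i; lia.
pose phi (z : {ffun 'I_n -> 'I_b}) : {ffun 'I_n -> 'I_(b + d)} :=
  [ffun i => Ordinal (lt i z)].
have phiI : injective phi.
  move=> y z /ffunP yz; apply/ffunP => i; apply: val_inj.
  by have := congr1 val (yz i); rewrite !ffunE/= => /addIn.
have -> : \sum_(z : {ffun 'I_n -> 'I_b})
      g (latt (fun i => z i) + eta *: \row_i (s i)%:R) =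
    \sum_z g (latt (fun i => phi z i)).
  apply: eq_bigr => z _; rewrite latt_shift; congr (g (latt _)).
  by apply/funext => i; rewrite ffunE.
rewrite -(big_imset (fun y : {ffun 'I_n -> 'I_(b + d)} => g (latt (fun i => y i)))
  (h := phi) (A := predT)); last by move=> y z _ _; exact: phiI.
rewrite [leRHS](bigID (mem (phi @: predT)))/= lerDl.
by apply: sumr_ge0.
Qed.

Lemma box_sum_mono b d g : (forall x, 0 <= g x) ->
  box_sum b g <= box_sum (b + d) g.
Proof.
move=> g0; have := @box_sum_shift b d (fun=> 0%N) g g0 (fun=> leq0n d).
apply: le_trans; rewrite le_eqVlt; apply/orP; left; apply/eqP.
apply: eq_bigr => z _.
by rewrite latt_shift; congr (g (latt _)); apply/funext => i; rewrite addn0.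
Qed.

Section Energy.
Variables (w : E -> R) (sa sb : 'I_n -> nat).
Hypothesis sab : forall i, (sa i + sb i <= 3)%N.
Let a := eta *: (\row_i (sa i)%:R : E).
Let b := eta *: (\row_i (sb i)%:R : E).
Let M := dyadic_fd w a b.
Let D k x := (M k x - M k (x + 2 ^+ k *: b)) ^+ 2.

Let scale_shift k (s : 'I_n -> nat) :
  2 ^+ k *: (eta *: (\row_i (s i)%:R : E)) =
  eta *: \row_i ((2 ^ k * s i)%N)%:R.
Proof.
rewrite !scalerA mulrC -scalerA; congr (_ *: _).
by apply/rowP => i; rewrite !mxE natrM natrX.
Qed.

(** This is [sqr_avg4] summed over the box. The four averaged points are shifts by at most
    [3 * 2 ^ k] grid steps, hence the larger box on the right. *)
Let energy_step k c :
  box_sum c (D k) / 8 + box_sum c (fun x => M k.+1 x ^+ 2) <=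
  box_sum (c + 3 * 2 ^ k) (fun x => M k x ^+ 2).
Proof.
set g := fun x => M k x ^+ 2.
have g0 x : 0 <= g x by rewrite sqr_ge0.
have h (s : 'I_n -> nat) : (forall i, s i <= 3)%N ->
    box_sum c (fun x => g (x + 2 ^+ k *: (eta *: (\row_i (s i)%:R : E)))) <=
    box_sum (c + 3 * 2 ^ k) g.
  move=> s3; rewrite scale_shift; apply: box_sum_shift => // i.
  by rewrite mulnC leq_mul2r s3 orbT.
have h0 := h (fun=> 0%N) (fun=> isT).
have ha := h sa (fun i => leq_trans (leq_addr _ _) (sab i)).
have hb := h sb (fun i => leq_trans (leq_addl _ _) (sab i)).
have hab := h (fun i => sa i + sb i)%N sab.
apply: (@le_trans _ _ ((box_sum c (fun x => g (x)) +
  box_sum c (fun x => g (x + 2 ^+ k *: b)) +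
  box_sum c (fun x => g (x + 2 ^+ k *: a)) +
  box_sum c (fun x => g (x + 2 ^+ k *: a + 2 ^+ k *: b))) / 4)).
  rewrite /box_sum mulr_suml -!big_split/= mulr_suml; apply: ler_sum => z _.
  by rewrite /M dyadic_fdS; exact: sqr_avg4.
have e0 : box_sum c (fun x => g (x + 2 ^+ k *: (eta *: (\row_i 0%N%:R : E)))) =
   box_sum c g.
  apply: eq_bigr => z _; congr g; rewrite scale_shift -[RHS]addr0; congr (_ + _).
  by apply/rowP => i; rewrite !mxE muln0 mulr0.
have eab : box_sum c (fun x => g (x + 2 ^+ k *: a + 2 ^+ k *: b)) =
  box_sum c (fun x => g (x + 2 ^+ k *: (eta *: (\row_i (sa i + sb i)%N%:R : E)))).
  apply: eq_bigr => z _; congr g; rewrite -addrA; congr (_ + _).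
  rewrite -scalerDr -scalerDr; congr (_ *: (_ *: _)).
  by apply/rowP => i; rewrite !mxE natrD.
rewrite e0 in h0; rewrite eab /a /b.
by lra.
Qed.

(** The sums of squares telescope over the scales, and the enlargements [3 * 2 ^ k] of the box add
    up to less than [3 * 2 ^ K]. *)
Lemma energy_telescope K c :
  \sum_(k < K) box_sum c (D k) / 8 <=
  box_sum (c + 3 * 2 ^ K) (fun x => M 0 x ^+ 2).
Proof.
suff : \sum_(k < K) box_sum c (D k) / 8 + box_sum c (fun x => M K x ^+ 2) <=
  box_sum (c + 3 * 2 ^ K) (fun x => M 0 x ^+ 2).
  apply: le_trans; rewrite lerDl; apply: sumr_ge0 => z _; exact: sqr_ge0.
elim: K c => [|K IH] c.
  by rewrite big_ord0 add0r; apply: box_sum_mono => x; exact: sqr_ge0.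
rewrite big_ord_recr/= -addrA.
apply: (le_trans (lerD (lexx _) (energy_step K c))).
rewrite expnS mulnA (_ : (3 * 2 * 2 ^ K = 3 * 2 ^ K + 3 * 2 ^ K)%N); last lia.
rewrite addnA; apply: le_trans (IH _); rewrite lerD2r.
apply: ler_sum => k _; rewrite ler_pM2r ?invr_gt0//.
by apply: box_sum_mono => x; exact: sqr_ge0.
Qed.

End Energy.
End Box.
End Differences.

(** * Most grid points are flat at some dyadic scale *)

Section Counting.
Variables (R : realType) (n : nat).
Notation E := 'rV[R]_n.
Implicit Types (w : E -> R) (x : E).

Definition nvec (s : 'I_n -> nat) : E := \row_i (s i)%:R.

Definition unit_dir (i : 'I_n) : 'I_n -> nat := fun k => (k == i)%N.

(** For [j = l] this is [e_j] and not its double, so one family contains both the [e_j] and the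
    [e_j + e_l]. *)
Definition diag_dir (j l : 'I_n) : 'I_n -> nat :=
  fun k => ((k == j) || (k == l))%N.

Lemma nvec_unit i : nvec (unit_dir i) = delta_mx 0 i.
Proof. by apply/rowP => k; rewrite !mxE. Qed.

Lemma nvec_diag j l : j != l -> nvec (diag_dir j l) = delta_mx 0 j + delta_mx 0 l.
Proof.
move=> jl; apply/rowP => k; rewrite !mxE/= /diag_dir.
have [->|kj] := eqVneq k j; last by rewrite add0r.
by rewrite (negPf jl) addr0.
Qed.

Lemma nvec_diag_id j : nvec (diag_dir j j) = delta_mx 0 j.
Proof. by apply/rowP => k; rewrite !mxE/= /diag_dir orbb. Qed.

(* The third differences along [e_i, b, b] are small.  Taking [b = e_j + e_l]
   besides [b = e_j] gives, by polarisation, all third differences. *)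
Definition flat_at w rho tau x := forall i j l,
  let b := rho *: nvec (diag_dir j l) in
  `|fd (rho *: nvec (unit_dir i)) (fd b w) x -
    fd (rho *: nvec (unit_dir i)) (fd b w) (x + b)| <= tau * rho ^+ 2.

Section NonFlat.
Variables (w : E -> R) (C eta tau : R) (o : E).
Hypotheses (ts : two_sided C w) (C0 : 0 <= C) (eta0 : 0 < eta) (tau0 : 0 < tau).

Let T := ('I_n * 'I_n * 'I_n)%type.
Let va (t : T) := eta *: nvec (unit_dir t.1.1).
Let vb (t : T) := eta *: nvec (diag_dir t.1.2 t.2).
Let D (t : T) k x := (dyadic_fd w (va t) (vb t) k x -
  dyadic_fd w (va t) (vb t) k (x + 2 ^+ k *: vb t)) ^+ 2.

Definition non_flat_set c k : {set {ffun 'I_n -> 'I_c}} :=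
  [set z : {ffun 'I_n -> 'I_c} | ~~ `[< flat_at w (2 ^+ k * eta) tau
     (latt o eta (fun i => z i)) >] ].

(** Division by [4 ^+ k] turns the threshold [tau * rho ^+ 2] at [rho = 2 ^+ k * eta] into
    [tau * eta ^+ 2], the same at every scale. *)
Let non_flat_defect k x : ~ flat_at w (2 ^+ k * eta) tau x ->
  (tau * eta ^+ 2) ^+ 2 <= \sum_t D t k x.
Proof.
move=> nf.
have [t ht] : exists t : T, tau * eta ^+ 2 < `|dyadic_fd w (va t) (vb t) k x -
    dyadic_fd w (va t) (vb t) k (x + 2 ^+ k *: vb t)|.
  apply: contrapT => /forallNP h; apply: nf => i j l /=.
  have /negP := h (i, j, l); rewrite -leNgt /dyadic_fd /va /vb /= !scalerA.
  rewrite -mulrBl normrM normfV (ger0_norm (exprn_ge0 _ _))//.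
  rewrite ler_pdivrMr ?exprn_gt0// => h1.
  apply: le_trans h1 _; rewrite (_ : 4 = 2 ^+ 2); last by ring.
  by rewrite -exprM mulnC exprM exprMn [leRHS]mulrA mulrAC.
rewrite (bigD1 t)//= -[leLHS]addr0; apply: lerD.
  rewrite /D -[leRHS](real_normK (num_real _)) lerXn2r ?nnegrE ?(ltW ht)//.
  by rewrite mulr_ge0 ?exprn_ge0// ltW.
by apply: sumr_ge0 => i _; exact: sqr_ge0.
Qed.

(** Chebyshev's inequality: a non-flat point costs a fixed amount of the energy bounded in
    [energy_telescope]. The constant collects [n ^ 3] triples of directions, the factor [8] and the
    square of the bound [2 n C eta^2] of [two_sided_fd]. *)
Lemma sum_card_non_flat K c :
  (\sum_(k < K) #|non_flat_set c k|%:R) * tau ^+ 2 <=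
  (32 * n ^ 5)%:R * C ^+ 2 * ((c + 3 * 2 ^ K) ^ n)%:R.
Proof.
have e4 : 0 < eta ^+ 4 by rewrite exprn_gt0.
rewrite -(ler_pM2r e4).
apply: (@le_trans _ _ (\sum_(k < K) \sum_t box_sum o eta c (D t k))).
  rewrite -mulrA mulr_suml; apply: ler_sum => k _.
  rewrite /box_sum exchange_big/= -sum1_card natr_sum mulr_suml big_mkcond/=.
  apply: ler_sum => z _; rewrite inE.
  case: asboolP => /= [_|nf]; first by apply: sumr_ge0 => t _; exact: sqr_ge0.
  by have := non_flat_defect nf; rewrite mul1r exprMn -exprM.
rewrite exchange_big/=.
have ht t : \sum_(k < K) box_sum o eta c (D t k) <=
    8 * (((c + 3 * 2 ^ K) ^ n)%:R * (2 * n%:R * C * eta ^+ 2) ^+ 2).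
  rewrite -ler_pdivrMl// mulrC mulr_suml.
  have := @energy_telescope R n o eta w (unit_dir t.1.1) (diag_dir t.1.2 t.2) _ K c.
  move=> h; apply: le_trans (h _) _.
    by move=> i; rewrite /unit_dir /diag_dir; case: eqP; case: eqP; case: eqP.
  rewrite /box_sum.
  apply: (@le_trans _ _ (\sum_(z : {ffun 'I_n -> 'I_(c + 3 * 2 ^ K)})
     (2 * n%:R * C * eta ^+ 2) ^+ 2)); last first.
by rewrite sumr_const card_ffun !card_ord [leRHS]mulr_natl.
  apply: ler_sum => z _; apply: sqr_le_norm.
  rewrite /dyadic_fd !expr0 !scale1r divr1.
  apply: le_trans (two_sided_fd _ _ _ ts) _.
  have d (s : 'I_n -> nat) : (forall i, s i <= 1)%N ->
      dot (eta *: nvec s) (eta *: nvec s) <= n%:R * eta ^+ 2.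
    move=> s1; apply: dot_le_coord; first exact: ltW.
    move=> i; rewrite !mxE normrM gtr0_norm// ler_piMr// ?(ltW eta0)//.
    by rewrite ger0_norm ?ler0n// -[leRHS]/(1%:R) ler_nat s1.
  have d1 := d _ (fun i => leq_b1 (i == t.1.1)).
  have d2 := d _ (fun i => leq_b1 ((i == t.1.2) || (i == t.2))).
  rewrite (_ : _ * eta ^+ 2 = C * (n%:R * eta ^+ 2 + n%:R * eta ^+ 2)); last by ring.
  by rewrite ler_wpM2l// lerD.
apply: (le_trans (ler_sum _ (fun t _ => ht t))).
rewrite sumr_const !card_prod !card_ord -mulr_natl !natrM !natrX.
by rewrite le_eqVlt; apply/orP; left; apply/eqP; ring.
Qed.

(** Pigeonhole. Otherwise, at each of the [K] scales, the cube of [Q ^ n] points attached to each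
    [p] contains a non-flat point. That point and its position in the cube determine [p], so every
    scale has at least [m ^ n / Q ^ n] non-flat points, too many for [sum_card_non_flat]. *)
Lemma exists_flat (m c K L Q : nat) (bet : {ffun 'I_n -> 'I_m} -> 'I_n -> nat) :
  injective bet ->
  (forall k p i, k < K -> L * 2 ^ k <= bet p i)%N ->
  (forall k p i, k < K -> bet p i + Q * 2 ^ k <= c)%N ->
  (32 * n ^ 5)%:R * C ^+ 2 * ((c + 3 * 2 ^ K) ^ n)%:R * (Q ^ n)%:R <
    (K * m ^ n)%:R * tau ^+ 2 ->
  exists k p, (k < K)%N /\ forall z : 'I_n -> nat, (forall i, z i < Q)%N ->
    flat_at w (2 ^+ k * eta) tau
      (latt o eta (fun i => bet p i - L * 2 ^ k + 2 ^ k * z i)%N).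
Proof.
move=> betI betL betc big; apply: contrapT => nex.
suff h (k : 'I_K) : (m ^ n <= Q ^ n * #|non_flat_set c k|)%N.
  have := sum_card_non_flat K c; rewrite leNgt => /negP; apply.
  rewrite -(ltr_pM2r (_ : 0 < (Q ^ n)%:R)); last first.
    rewrite ltr0n lt0n; apply/negP => /eqP Q0; move: big.
    rewrite Q0 mulr0 => big.
    have K0 : (0 < K)%N by case: (K) big => //; rewrite mul0n mul0r ltxx.
    have := h (Ordinal K0); rewrite Q0 mul0n leqn0 => /eqP m0.
    by move: big; rewrite m0 muln0 mul0r ltxx.
  apply: lt_le_trans big _; rewrite mulrAC ler_wpM2r ?sqr_ge0//.
  rewrite -natr_sum -natrM ler_nat.
  rewrite big_distrl/= -[leqLHS]/(K * m ^ n)%N -{1}(card_ord K) -sum_nat_const.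
  by apply: leq_sum => k _; rewrite mulnC h.
have hz p : exists z : {ffun 'I_n -> 'I_Q}, ~ flat_at w (2 ^+ k * eta) tau
      (latt o eta (fun i => bet p i - L * 2 ^ k + 2 ^ k * z i)%N).
  apply: contrapT => /forallNP nz; apply: nex; exists k, p; split => // z zQ.
  have := nz [ffun i => Ordinal (zQ i)] => /contrapT.
  by rewrite (_ : (fun i => _) = (fun i => bet p i - L * 2 ^ k + 2 ^ k * z i)%N)//;
    apply/funext => i; rewrite ffunE.
have [zeta zetaP] := choice hz.
have ltc p (z : {ffun 'I_n -> 'I_Q}) i :
    (bet p i - L * 2 ^ k + 2 ^ k * z i < c)%N.
  have := betc k p i (ltn_ord k); have := betL k p i (ltn_ord k).
  have := ltn_ord (z i); have : (0 < 2 ^ k)%N by rewrite expn_gt0.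
  by nia.
pose phi p : {ffun 'I_n -> 'I_Q} * {ffun 'I_n -> 'I_c} :=
  (zeta p, [ffun i => Ordinal (ltc p (zeta p) i)]).
have phiI : injective phi.
  (* Equal positions [zeta] leave equal differences [bet p i - L * 2 ^ k], and these determine
     [bet p i] because [betL] rules out truncation at zero. *)
  move=> p q [zpq /ffunP bpq]; apply: betI; apply/funext => i.
  have := congr1 val (bpq i); rewrite !ffunE/= zpq => /addIn.
  have := betL k p i (ltn_ord k); have := betL k q i (ltn_ord k); lia.
have -> : (m ^ n = #|phi @: [set: {ffun 'I_n -> 'I_m}]%SET|)%N.
  by rewrite card_imset// cardsT card_ffun !card_ord.
have -> : (Q ^ n * #|non_flat_set c k| =
    #|finset.setX [set: {ffun 'I_n -> 'I_Q}]%SET (non_flat_set c k)|)%N.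
  by rewrite cardsX cardsT card_ffun !card_ord.
apply: subset_leq_card; apply/fintype.subsetP => _ /imsetP[p _ ->].
rewrite !inE/=; apply/asboolPn => h; apply: (zetaP p); move: h.
rewrite (_ : (fun i => _) = (fun i => bet p i - L * 2 ^ k + 2 ^ k * zeta p i)%N)//.
by apply/funext => i; rewrite ffunE.
Qed.

End NonFlat.
End Counting.

(** * Small third differences and quadratic polynomials *)

Section Quad.
Variables (R : realType) (n : nat).
Notation E := 'rV[R]_n.
Implicit Types (w : E -> R) (x g : E) (H : 'M[R]_n).

Definition quad (c : R) g H x : R := c + dot g x + dot (x *m H) x / 2.

Lemma quadD c g H x y : H^T = H ->
  quad c g H (x + y) = quad c g H x + dot (g + x *m H) y + dot (y *m H) y / 2.
Proof.
by move=> sH; rewrite /quad mulmxDl !dotE (mulmx_dot_sym y x sH); field.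
Qed.

Lemma quad_segment c g H x y (s : R) : H^T = H ->
  quad c g H (x + s *: y) - s * quad c g H (x + y) - (1 - s) * quad c g H x =
  - (s * (1 - s) * (dot (y *m H) y / 2)).
Proof.
by move=> sH; rewrite !quadD// -scalemxAl !dotE; field.
Qed.

Lemma fd_quad c g H x a : H^T = H ->
  fd a (quad c g H) x = dot (g + x *m H) a + dot (a *m H) a / 2.
Proof. by move=> sH; rewrite /fd quadD//; ring. Qed.

Lemma fd2_quad c g H x a b : H^T = H ->
  fd b (fd a (quad c g H)) x = dot (b *m H) a.
Proof.
by move=> sH; rewrite {1}/fd !fd_quad// mulmxDl !dotE; ring.
Qed.

Lemma fd_sub a (f h : E -> R) x : fd a (fun y => f y - h y) x = fd a f x - fd a h x.
Proof. by rewrite /fd; ring. Qed.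

Lemma dot_mulmx_delta H i j : dot (delta_mx 0 i *m H) (delta_mx 0 j) = H i j.
Proof. by rewrite dot_delta -rowE mxE. Qed.

(** Polarisation of the third difference in [q] and [r]; the shifted base points make it exact for
    finite steps. *)
Lemma third_fd w x p q r :
  fd r (fd p (fd q w)) x * 2 =
  (fd p (fd r w) (x + (q + q)) - fd p (fd r w) (x + (q + q) + r)) +
  (fd p (fd q w) (x + r) - fd p (fd q w) (x + r + q)) * 2 -
  (fd p (fd q w) x - fd p (fd q w) (x + q)) -
  (fd p (fd (q + r) w) x - fd p (fd (q + r) w) (x + (q + r))).
Proof.
rewrite /fd !addrA.
do 3 rewrite ?(addrAC _ q p) ?(addrAC _ r p) ?(addrAC _ r q).
by ring.
Qed.

Section Lattice.
Variables (w : E -> R) (C rho tau : R) (x0 : E) (M : nat).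
Hypotheses (ts : two_sided C w) (C0 : 0 <= C) (rho0 : 0 < rho) (tau0 : 0 <= tau).
Hypothesis M0 : (0 < M)%N.
Hypothesis flat : forall z : 'I_n -> nat, (forall i, z i < M + 3)%N ->
  flat_at w rho tau (x0 + rho *: nvec R z).

Let P (z : 'I_n -> nat) : E := x0 + rho *: nvec R z.
Let e i : E := rho *: delta_mx 0 i.

Let P_unit z i : P z + e i = P (fun k => z k + unit_dir i k)%N.
Proof.
rewrite /P /e -nvec_unit -addrA -scalerDr; congr (_ + _ *: _).
by apply/rowP => k; rewrite !mxE natrD.
Qed.

Let P0 : P (fun=> 0%N) = x0.
Proof.
rewrite /P (_ : nvec _ _ = 0) ?scaler0 ?addr0//.
by apply/rowP => k; rewrite !mxE.
Qed.

Let third_small z i j l : (forall k, z k <= M)%N ->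
  `|fd (e l) (fd (e i) (fd (e j) w)) (P z)| <= 3 * tau * rho ^+ 2.
Proof.
move=> zM.
have tr : 0 <= tau * rho ^+ 2 by rewrite mulr_ge0 ?sqr_ge0//.
have ub (k k' : 'I_n) : (unit_dir k k' <= 1)%N by exact: leq_b1.
have f0 : flat_at w rho tau (P z).
  by apply: flat => k; have := zM k; lia.
have [<-|jl] := eqVneq j l.
  have := f0 i j j; rewrite /= nvec_diag_id nvec_unit -/(e i) -/(e j).
  by rewrite distrC => h; rewrite {1}/fd; apply: le_trans h _; lra.
have fl : flat_at w rho tau (P z + e l).
  by rewrite P_unit; apply: flat => k; have := ub l k; have := zM k; lia.
(* The base points in [third_fd] lie at most two grid steps beyond [P z], within the range [M + 3]
   of [flat]. *)
have fj : flat_at w rho tau (P z + (e j + e j)).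
  rewrite addrA !P_unit; apply: flat => k.
  by have := ub j k; have := zM k; lia.
have := f0 i j l; have := f0 i j j; have := fl i j j; have := fj i l l.
rewrite /= !nvec_diag_id nvec_diag// !nvec_unit scalerDr -!/(e _).
have := third_fd w (P z) (e i) (e j) (e l).
set A := fd _ _ _ - _; set B := fd _ _ _ - _; set D := fd _ _ _ - _.
set F := fd _ _ _ - _.
rewrite !ler_norml => h /andP[a1 a2] /andP[b1 b2] /andP[c1 c2] /andP[d1 d2].
by apply/andP; split; lra.
Qed.

(** The increments are summed along a lattice path from [x0] to [P z], which has at most [n * M]
    unit steps. *)
Let path_bound (G : E -> R) B : 0 <= B ->
  (forall z i, (forall k, z k <= M)%N -> `|fd (e i) G (P z)| <= B) ->
  G x0 = 0 ->
  forall z, (forall k, z k <= M)%N -> `|G (P z)| <= (n * M)%:R * B.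
Proof.
move=> B0 hG G0 z zM.
suff h s : forall z, (forall k, z k <= M)%N -> (\sum_k z k = s)%N ->
    `|G (P z)| <= s%:R * B.
  apply: le_trans (h _ z zM erefl) _; rewrite ler_wpM2r// ler_nat.
  apply: (@leq_trans (\sum_(k < n) M)%N); first exact: leq_sum.
  by rewrite sum_nat_const card_ord.
elim: s => [|s IH] {}z {}zM zs.
  rewrite (_ : z = fun=> 0%N) ?P0 ?G0 ?normr0 ?mul0r//; apply/funext => k.
  by move/eqP: zs; rewrite sum_nat_eq0 => /forallP/(_ k)/eqP.
have [i zi] : exists i, (0 < z i)%N.
  apply: contrapT => /forallNP h; move: zs; rewrite big1// => k _.
  by have /negP := h k; rewrite -eqn0Ngt => /eqP.
pose z' k := (z k - unit_dir i k)%N.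
have zE : z = fun k => (z' k + unit_dir i k)%N.
  apply/funext => k; rewrite /z' /unit_dir subnK//.
  by case: eqP => // ->.
have z'M k : (z' k <= M)%N by rewrite (leq_trans (leq_subr _ _)).
have z's : (\sum_k z' k = s)%N.
  have : (\sum_k z k = \sum_k z' k + 1)%N.
    rewrite {1}zE big_split/=; congr (_ + _)%N.
    rewrite (bigD1 i)//= /unit_dir eqxx big1// => k ki.
    by rewrite (negPf ki).
  by rewrite zs addn1 => -[].
have := IH _ z'M z's; have := hG z' i z'M.
rewrite {1}/fd P_unit -zE -natr1 !ler_norml => /andP[h1 h2] /andP[h3 h4].
by apply/andP; split; lra.
Qed.

Let H : 'M[R]_n := \matrix_(i, j) (fd (e i) (fd (e j) w) x0 / rho ^+ 2).

Let Hsym : H^T = H.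
Proof. by apply/matrixP => i j; rewrite !mxE fdC. Qed.

Let r2 : rho ^+ 2 != 0. Proof. by rewrite expf_neq0// gt_eqF. Qed.

Let deltaH i j : dot (e i *m H) (e j) = fd (e i) (fd (e j) w) x0.
Proof.
rewrite /e -scalemxAl !dotE dot_mulmx_delta mxE -!/(e _).
by field; rewrite gt_eqF.
Qed.

(** The coefficients are those of the quadratic [q] with the same value, first and second
    differences as [w] at [x0]; the term [rho * H i i / 2] removes the second-order part of a first
    difference. *)
Let g0 : E := \row_i (fd (e i) w x0 / rho - rho * H i i / 2).
Let g : E := g0 - x0 *m H.
Let c0 : R := w x0 - dot g x0 - dot (x0 *m H) x0 / 2.
Let q := quad c0 g H.
Let G x := w x - q x.

Let G_x0 : G x0 = 0.
Proof. by rewrite /G /q /quad /c0; ring. Qed.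

Let fdG_x0 i : fd (e i) G x0 = 0.
Proof.
have hd : dot g0 (e i) = rho * g0 0 i by rewrite /e dotZr dot_delta.
rewrite /G fd_sub fd_quad// /g subrK deltaH hd !mxE.
by field; rewrite gt_eqF.
Qed.

Let fd2G_x0 i j : fd (e i) (fd (e j) G) x0 = 0.
Proof.
have -> : fd (e j) G = fun x => fd (e j) w x - fd (e j) q x.
  by apply/funext => x; exact: fd_sub.
by rewrite fd_sub fd2_quad// deltaH subrr.
Qed.

Let fd3G i j l x : fd (e l) (fd (e i) (fd (e j) G)) x =
  fd (e l) (fd (e i) (fd (e j) w)) x.
Proof.
have -> : fd (e j) G = fun x => fd (e j) w x - fd (e j) q x.
  by apply/funext => y; exact: fd_sub.
have -> : fd (e i) (fun x => fd (e j) w x - fd (e j) q x) =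
   fun x => fd (e i) (fd (e j) w) x - dot (e i *m H) (e j).
  by apply/funext => y; rewrite fd_sub fd2_quad.
by rewrite fd_sub [X in _ - X = _]/fd subrr subr0.
Qed.

Let beta := (n * M)%:R ^+ 3 * (3 * tau * rho ^+ 2).

(** Subtracting [q] leaves the third differences unchanged, and the lower ones vanish at [x0]. So
    [path_bound] is applied three times, each at the cost of a factor [n * M]. *)
Let G_lattice z : (forall k, z k <= M)%N -> `|G (P z)| <= beta.
Proof.
have B0 : 0 <= 3 * tau * rho ^+ 2 by rewrite -mulrA mulr_ge0// mulr_ge0 ?sqr_ge0.
have h2 i j z' : (forall k, z' k <= M)%N ->
    `|fd (e i) (fd (e j) G) (P z')| <= (n * M)%:R * (3 * tau * rho ^+ 2).
  apply: path_bound => // z2 l z2M.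
  by rewrite fd3G; exact: third_small.
have h1 j z' : (forall k, z' k <= M)%N ->
    `|fd (e j) G (P z')| <= (n * M)%:R * ((n * M)%:R * (3 * tau * rho ^+ 2)).
  apply: path_bound => [|z2 l z2M|//]; last exact: h2.
  by rewrite mulr_ge0.
move=> zM; rewrite /beta (_ : _ * _ =
  (n * M)%:R * ((n * M)%:R * ((n * M)%:R * (3 * tau * rho ^+ 2)))); last by ring.
apply: path_bound => //; first by do 2 apply: mulr_ge0 => //.
by move=> z2 l z2M; exact: h1.
Qed.

(** On a segment of length [rho], both [w] and [q] deviate from linear interpolation by at most
    [C * rho ^+ 2 / 4]: [w] by [two_sided], [q] because [two_sided_fd] bounds its second
    differences. *)
Let G_segment x i (s : R) : 0 <= s <= 1 ->
  `|G (x + s *: e i)| <= s * `|G (x + e i)| + (1 - s) * `|G x| + C * rho ^+ 2.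
Proof.
move=> s01; have /andP[s0 s1] := s01.
have := ts (x + e i) x s01.
have -> : s *: (x + e i) + (1 - s) *: x = x + s *: e i.
  by rewrite scalerDr addrAC -scalerDl (addrC s) subrK scale1r.
have -> : x + e i - x = e i by rewrite (addrC x) addrK.
have -> : dot (e i) (e i) = rho ^+ 2.
  by rewrite /e !dotE dot_delta mxE !eqxx/=; ring.
have hq := quad_segment c0 g x (e i) s Hsym.
have hH : `|dot (e i *m H) (e i)| <= C * (rho ^+ 2 + rho ^+ 2).
  rewrite deltaH; apply: le_trans (two_sided_fd _ _ _ ts) _.
  by rewrite /e !dotE dot_delta mxE !eqxx/= !mulr1 -expr2.
move: hH; rewrite -mulr2n -[rho ^+ 2 *+ 2]mulr_natl => hH.
have ss : 0 <= s * (1 - s) <= 4^-1.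
  apply/andP; split; first by rewrite mulr_ge0// subr_ge0.
  have := sqr_ge0 (s - 2^-1); rewrite sqrrB expr2; lra.
have hq' : `|s * (1 - s) * (dot (e i *m H) (e i) / 2)| <= C * rho ^+ 2 / 4.
  rewrite normrM (ger0_norm (andP ss).1) normrM normfV (ger0_norm (ler0n _ 2)).
  rewrite (_ : C * rho ^+ 2 / 4 = 4^-1 * (C * (2 * rho ^+ 2) / 2)); last by field.
  apply: ler_pM; [exact: (andP ss).1|by rewrite mulr_ge0|exact: (andP ss).2|].
  by rewrite ler_pM2r ?invr_gt0.
have hr : 0 <= C * rho ^+ 2 by rewrite mulr_ge0 ?sqr_ge0.
have hw : C * (s * (1 - s)) * rho ^+ 2 <= C * rho ^+ 2 / 4.
  rewrite (_ : C * (s * _) * _ = s * (1 - s) * (C * rho ^+ 2)); last by ring.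
  by rewrite [leRHS]mulrC ler_wpM2r// (andP ss).2.
move=> h; have {hw}h := le_trans h hw.
have n1 := ler_norm (G (x + e i)); have n2 := ler_norm (- G (x + e i)).
have n3 := ler_norm (G x); have n4 := ler_norm (- G x).
rewrite !normrN in n2 n4.
have m1 : s * G (x + e i) <= s * `|G (x + e i)| by rewrite ler_wpM2l.
have m2 : s * - G (x + e i) <= s * `|G (x + e i)| by rewrite ler_wpM2l.
have m3 : (1 - s) * G x <= (1 - s) * `|G x| by rewrite ler_wpM2l ?subr_ge0.
have m4 : (1 - s) * - G x <= (1 - s) * `|G x| by rewrite ler_wpM2l ?subr_ge0.
move: h hq'; rewrite ler_norml => /andP[h1 h2].
rewrite -/q in hq; rewrite ler_norml => /andP[h3 h4].
rewrite ler_norml; move: m1 m2 m3 m4.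
set N1 := `|G (x + e i)|; set N2 := `|G x|; rewrite /G => m1 m2 m3 m4.
by apply/andP; split; lra.
Qed.

Lemma lattice_quadratic : exists c g' H', H'^T = H' /\
  forall y, (forall i, 0 <= (y - x0) 0 i <= M%:R * rho) ->
  `|w y - quad c g' H' y| <=
     ((n * M)%:R ^+ 3 * (3 * tau) + n%:R * C) * rho ^+ 2.
Proof.
exists c0, g, H; split; first exact: Hsym.
have hr : 0 <= C * rho ^+ 2 by rewrite mulr_ge0 ?sqr_ge0//.
(* Induction on the number [k] of coordinates allowed to leave the lattice; [G_segment] frees one
   more at the cost of [C * rho ^+ 2]. *)
suff h k y : (k <= n)%N -> (forall i, 0 <= (y - x0) 0 i <= M%:R * rho) ->
    (forall i : 'I_n, (k <= i)%N ->
      exists2 m, (m <= M)%N & (y - x0) 0 i = rho * m%:R) ->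
    `|G y| <= beta + k%:R * (C * rho ^+ 2).
  move=> y hy; have := h n y (leqnn n) hy; rewrite /G /beta.
  rewrite [X in _ -> _ <= X](_ : _ = (n * M)%:R ^+ 3 * (3 * tau * rho ^+ 2) +
      n%:R * (C * rho ^+ 2)); last by ring.
  by apply => i; rewrite leqNgt ltn_ord.
elim: k y => [|k IH] y kn hy hl.
  have hz i : exists m, (m <= M)%N /\ (y - x0) 0 i = rho * m%:R.
    by have [m ? ?] := hl i isT; exists m.
  have [z zP] := choice hz.
  rewrite mul0r addr0 (_ : y = P z); first by apply: G_lattice => i; have [] := zP i.
  apply/eqP; rewrite /P addrC -subr_eq; apply/eqP/rowP => i.
  by have [_ ->] := zP i; rewrite !mxE.
pose i0 := Ordinal kn.
have /andP[y0 yM] := hy i0.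
pose t := (y - x0) 0 i0 / rho.
have t0 : 0 <= t by rewrite divr_ge0// ltW.
have tM : t <= M%:R by rewrite ler_pdivrMr.
have [m [mM /andP[mt tm]]] : exists m, (m < M)%N /\ m%:R <= t <= m.+1%:R.
  have /andP[u1 u2] := truncn_itv t0.
  have [h|h] := ltnP (Num.truncn t) M.
    by exists (Num.truncn t); split => //; rewrite u1 ltW.
  (* At the far face, where [t = M], the last cell is used so that both endpoints stay in the
     cube. *)
  exists M.-1; rewrite prednK// tM andbT; split => //.
  by apply: le_trans u1; rewrite ler_nat (leq_trans (leq_pred M) h).
set s := t - m%:R.
have s01 : 0 <= s <= 1.
  by rewrite /s subr_ge0 mt/= lerBlDr addrC natr1.
pose Y := y - s *: e i0.
have Yi0 i : (Y - x0) 0 i = (y - x0) 0 i - s * rho * (i == i0)%:R.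
  by rewrite /Y /e addrAC !mxE eqxx/=; ring.
have Xi0 i : (Y + e i0 - x0) 0 i = (Y - x0) 0 i + rho * (i == i0)%:R.
  by rewrite addrAC mxE; congr (_ + _); rewrite /e !mxE eqxx.
have sr : s * rho = (y - x0) 0 i0 - rho * m%:R.
  by rewrite /s /t; field; exact: lt0r_neq0.
have Yi i : (Y - x0) 0 i = if i == i0 then rho * m%:R else (y - x0) 0 i.
  rewrite Yi0 sr; case: eqP => [->|_]; last by rewrite mulr0 subr0.
  by rewrite mulr1n; ring.
have Xi i : (Y + e i0 - x0) 0 i = if i == i0 then rho * m.+1%:R else (y - x0) 0 i.
  rewrite Xi0 Yi; case: eqP => _; last by rewrite mulr0 addr0.
  by rewrite mulr1n -natr1; ring.
have rM j : (j <= M)%N -> 0 <= rho * j%:R <= M%:R * rho.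
  move=> jM; rewrite (mulr_ge0 (ltW rho0) (ler0n _ _))/= mulrC.
  by rewrite ler_pM2r// ler_nat.
have hY : `|G Y| <= beta + k%:R * (C * rho ^+ 2).
  apply: IH; first exact: ltnW.
    by move=> i; rewrite Yi; case: ifP => // _; apply: rM; exact: ltnW.
  move=> i ki; rewrite Yi; case: eqP => [_|ii]; first by exists m => //; exact: ltnW.
  apply: hl; rewrite ltn_neqAle ki andbT; apply/eqP => ke; apply: ii.
  exact: val_inj.
have hX : `|G (Y + e i0)| <= beta + k%:R * (C * rho ^+ 2).
  apply: IH; first exact: ltnW.
    by move=> i; rewrite Xi; case: ifP => // _; apply: rM.
  move=> i ki; rewrite Xi; case: eqP => [_|ii]; first by exists m.+1.
  apply: hl; rewrite ltn_neqAle ki andbT; apply/eqP => ke; apply: ii.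
  exact: val_inj.
have -> : y = Y + s *: e i0 by rewrite /Y subrK.
apply: le_trans (G_segment Y i0 s01) _.
have /andP[s0 s1] := s01.
have l1 : s * `|G (Y + e i0)| <= s * (beta + k%:R * (C * rho ^+ 2)).
  by rewrite ler_wpM2l.
have l2 : (1 - s) * `|G Y| <= (1 - s) * (beta + k%:R * (C * rho ^+ 2)).
  by rewrite ler_wpM2l// subr_ge0.
by rewrite -natr1; lra.
Qed.

End Lattice.
End Quad.

(** * A scale at which [w] is almost quadratic *)

Section RegularScale.
Variables (R : realType) (n : nat).
Notation E := 'rV[R]_n.

Lemma latt_nvec (o : E) (eta : R) z s (a : nat) :
  latt o eta (fun i => z i + a * s i)%N = latt o eta z + (a%:R * eta) *: nvec R s.
Proof.
rewrite -(latt_shift o eta z (fun i => a * s i)%N) mulrC -scalerA.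
by congr (_ + _ *: _); apply/rowP => i; rewrite !mxE natrM.
Qed.

(** The order of choices is the point: [L] depends only on [C], [gam] and [n], and [N] on [B] and
    [j0] as well, but neither depends on [w], on the grid or on [bet]. The margin [j0] keeps the
    scale found well below the size of the whole grid. *)
Lemma regular_scale (C gam : R) : 0 <= C -> 0 < gam ->
  exists2 L : nat, (1 < L)%N & forall B j0 : nat, exists N : nat,
  forall (w : E -> R) (eta : R) (o : E)
    (bet : {ffun 'I_n -> 'I_(2 ^ N)} -> 'I_n -> nat),
  two_sided C w -> 0 < eta -> injective bet ->
  (forall p i, L * 2 ^ N <= bet p i <= B * 2 ^ N)%N ->
  exists k p c g H, [/\ (k + j0 < N)%N, H^T = H &
    let r := L%:R * (2 ^+ k * eta) in
    forall y, (forall i, `|(y - latt o eta (bet p)) 0 i| <= r) ->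
    `|w y - quad c g H y| <= gam * r ^+ 2].
Proof.
move=> C0 gam0.
(* With [r = L * rho], this [L] makes the interpolation error [n C rho^2] of [lattice_quadratic] at
   most half of [gam * r ^+ 2]. *)
pose L := (Num.truncn (2 * n%:R * C / gam)).+2.
have nC0 : 0 <= 2 * n%:R * C / gam by rewrite !mulr_ge0// invr_ge0 ltW.
have LP : n%:R * C <= gam * L%:R ^+ 2 / 2.
  have /andP[_ h] := truncn_itv nC0.
  have {}h : 2 * n%:R * C / gam < L%:R by rewrite (lt_le_trans h)// ler_nat.
  have L1 : 1 <= L%:R :> R by rewrite (_ : 1 = 1%:R)// ler_nat.
  have : 2 * n%:R * C < L%:R * gam by rewrite -ltr_pdivrMr.
  have : L%:R * gam <= L%:R ^+ 2 * gam.
    by rewrite ler_pM2r// expr2 ler_peMl// (le_trans _ L1).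
  lra.
exists L => // B j0.
pose d := (n * (2 * L))%:R ^+ 3 * 3 + 1 : R.
have d0 : 0 < d by rewrite ltr_wpDl// mulr_ge0// exprn_ge0.
(* The other half of [gam * r ^+ 2] pays for the third differences. *)
pose tau := gam * L%:R ^+ 2 / 2 / d.
have L2 : 0 < (L%:R : R) ^+ 2 by rewrite exprn_gt0// ltr0n.
have tau0 : 0 < tau by rewrite divr_gt0// divr_gt0// mulr_gt0.
(* A cube of [2 * L] steps centred at the grid point, with the margin of three that
   [lattice_quadratic] requires. *)
pose Q := (2 * L + 3)%N.
pose A0 : R := (32 * n ^ 5)%:R * C ^+ 2 * ((B + Q + 3) ^ n)%:R * (Q ^ n)%:R / tau ^+ 2.
have A00 : 0 <= A0 by rewrite !mulr_ge0 ?invr_ge0 ?sqr_ge0.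
(* [K > A0] is the counting hypothesis [big] of [exists_flat] after division by [(2 ^ N) ^ n] and
   [tau ^+ 2]. *)
pose K := (Num.truncn A0).+1.
pose N := (j0 + K)%N; exists N => w eta o bet ts eta0 betI betB.
have le2 k : (k < K)%N -> (2 ^ k <= 2 ^ N)%N.
  by move=> kK; rewrite leq_exp2l// (leq_trans (ltnW kK))// leq_addl.
have big : (32 * n ^ 5)%:R * C ^+ 2 *
    ((B * 2 ^ N + Q * 2 ^ N + 3 * 2 ^ K) ^ n)%:R * (Q ^ n)%:R <
    (K * (2 ^ N) ^ n)%:R * tau ^+ 2.
  have /andP[_ h] := truncn_itv A00; rewrite -/K in h.
  have T0 : 0 < ((2 ^ N) ^ n)%:R :> R by rewrite ltr0n !expn_gt0.
  have h1 : A0 * tau ^+ 2 * ((2 ^ N) ^ n)%:R < (K * (2 ^ N) ^ n)%:R * tau ^+ 2.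
    by rewrite natrM [ltRHS]mulrAC ltr_pM2r// ltr_pM2r ?exprn_gt0.
  apply: le_lt_trans h1; rewrite /A0 divfK ?expf_neq0 ?gt_eqF//.
  set X := ((_ + _ + _) ^ n)%N.
  have cmp : (X <= (B + Q + 3) ^ n * (2 ^ N) ^ n)%N.
    rewrite -expnMn /X; case: (posnP n) => [->|n0]; first by rewrite !expn0.
    rewrite leq_exp2r// !mulnDl leq_add2l.
    apply: leq_mul => //.
    by rewrite leq_exp2l// leq_addl.
  rewrite -(ler_nat R) natrM in cmp.
  rewrite [leLHS]mulrAC [leRHS](_ : _ = (32 * n ^ 5)%:R * C ^+ 2 * (Q ^ n)%:R *
    (((B + Q + 3) ^ n)%:R * ((2 ^ N) ^ n)%:R)); last by ring.
  by rewrite ler_wpM2l// !mulr_ge0// sqr_ge0.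
have [k [p [kK flat]]] := @exists_flat R n w C eta tau o ts C0 eta0 tau0
  (2 ^ N) (B * 2 ^ N + Q * 2 ^ N) K L Q bet betI
  (fun k p i kK => leq_trans (leq_mul (leqnn L) (le2 k kK)) (andP (betB p i)).1)
  (fun k p i kK => leq_add (andP (betB p i)).2 (leq_mul (leqnn Q) (le2 k kK)))
  big.
pose rho := 2 ^+ k * eta.
have rho0 : 0 < rho by rewrite mulr_gt0// exprn_gt0.
pose x0 := latt o eta (fun i => bet p i - L * 2 ^ k)%N.
have natp : (2 ^ k)%:R * eta = rho by rewrite natrX.
have xb : latt o eta (bet p) = x0 + rho *: nvec R (fun=> L).
  rewrite /x0 -natp -latt_nvec; congr (latt _ _ _); apply/funext => i.
  rewrite (mulnC (2 ^ k)%N) subnK//; apply: leq_trans (andP (betB p i)).1.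
  exact: leq_mul (leqnn L) (le2 k kK).
have [|c [g [H [Hs hq]]]] := @lattice_quadratic R n w C rho tau x0 (2 * L)
  ts C0 rho0 (ltW tau0) isT.
  move=> z zM; have := flat z zM; by rewrite latt_nvec natp.
exists k, p, c, g, H; split => //; first by rewrite /N addnC ltn_add2l.
move=> r y hy.
apply: le_trans (hq y _) _.
  move=> i; have := hy i; rewrite xb.
  have -> : (y - (x0 + rho *: nvec R (fun=> L))) 0 i = (y - x0) 0 i - rho * L%:R.
    by rewrite !mxE; ring.
  by rewrite ler_norml natrM /r -/rho => /andP[h1 h2]; apply/andP; split; lra.
rewrite /r -/rho [in leRHS]exprMn [leRHS]mulrA ler_pM2r ?exprn_gt0//.
have -> : (n * (2 * L))%:R ^+ 3 * (3 * tau) = (d - 1) * tau by rewrite /d; ring.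
have dt : d * tau = gam * L%:R ^+ 2 / 2.
  by rewrite /tau mulrC divfK// gt_eqF.
have tp := ltW tau0.
by rewrite mulrBl mul1r dt; lra.
Qed.

End RegularScale.

(** * Inf- and sup-convolutions *)

Section Convolution.
Variables (R : realType) (n : nat).
Notation E := 'rV[R]_n.
Implicit Types (f u v : E -> R) (A D : set E) (x y z p : E) (c s : R).

Lemma dot_convex s x y : let q z := dot z z in
  q (s *: x + (1 - s) *: y) = s * q x + (1 - s) * q y - s * (1 - s) * q (x - y).
Proof. by rewrite /= !dotE (dotC y x); ring. Qed.

Lemma dot_add_le x y : dot (x + y) (x + y) <= 2 * dot x x + 2 * dot y y.
Proof. by have := dot_ge0 (x - y); rewrite !dotE (dotC y x) => h; lra. Qed.

Lemma dot_subC x y : dot (x - y) (x - y) = dot (y - x) (y - x).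
Proof. by rewrite -(opprB y x) dotNl dotNr opprK. Qed.

Lemma dot_sub_le x y z : dot (x - z) (x - z) <=
  2 * dot (x - y) (x - y) + 2 * dot (y - z) (y - z).
Proof. by rewrite -(subrKA y x (- z)) dot_add_le. Qed.

Definition infconv f c A x : R :=
  inf [set f y + c * dot (x - y) (x - y) | y in A].

Definition conv_lb f c A := forall x, exists m, forall y, A y ->
  m <= f y + c * dot (x - y) (x - y).

Lemma infconv_le f c A x y : conv_lb f c A -> A y ->
  infconv f c A x <= f y + c * dot (x - y) (x - y).
Proof.
move=> lb Ay; apply: ge_inf; last by exists y.
by have [m hm] := lb x; exists m => _ [z Az <-]; exact: hm.
Qed.

Lemma le_infconv f c A x a : A !=set0 ->
  (forall y, A y -> a <= f y + c * dot (x - y) (x - y)) -> a <= infconv f c A x.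
Proof.
move=> [y0 Ay0] h; apply: lb_le_inf.
  by exists (f y0 + c * dot (x - y0) (x - y0)), y0.
by move=> _ [z Az <-]; exact: h.
Qed.

Lemma infconv_near f c A x e : conv_lb f c A -> A !=set0 -> 0 < e ->
  exists2 y, A y & f y + c * dot (x - y) (x - y) < infconv f c A x + e.
Proof.
move=> lb [y0 Ay0] e0.
have : has_inf [set f y + c * dot (x - y) (x - y) | y in A].
  split; first by exists (f y0 + c * dot (x - y0) (x - y0)), y0.
  by have [m hm] := lb x; exists m => _ [z Az <-]; exact: hm.
by move=> /(inf_adherent e0)[_ [y Ay <-] h]; exists y.
Qed.

(** An infimum of paraboloids of opening [c], for each of which this holds with equality by
    [dot_convex]. *)
Lemma infconv_semiconcave f c A x y s : conv_lb f c A -> A !=set0 ->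
  0 <= s <= 1 ->
  s * infconv f c A x + (1 - s) * infconv f c A y <=
  infconv f c A (s *: x + (1 - s) *: y) + c * (s * (1 - s)) * dot (x - y) (x - y).
Proof.
move=> lb A0 /andP[s0 s1]; rewrite -lerBlDr; apply: le_infconv => // z Az.
have h1 := infconv_le x lb Az; have h2 := infconv_le y lb Az.
have m1 : s * infconv f c A x <= s * (f z + c * dot (x - z) (x - z)).
  by rewrite ler_wpM2l.
have m2 : (1 - s) * infconv f c A y <= (1 - s) * (f z + c * dot (y - z) (y - z)).
  by rewrite ler_wpM2l// subr_ge0.
have -> : s *: x + (1 - s) *: y - z = s *: (x - z) + (1 - s) *: (y - z).
  by rewrite !scalerBr addrACA -opprD -scalerDl (addrC s) subrK scale1r.
rewrite dot_convex.
have -> : x - z - (y - z) = x - y by rewrite opprB addrA subrK.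
by lra.
Qed.

Section Regularisation.
Variables (u v : E -> R) (D : set E) (c M : R).
Hypotheses (c0 : 0 < c) (D0 : D !=set0).
Hypotheses (uM : forall x, D x -> `|u x| <= M) (vM : forall x, D x -> `|v x| <= M).

Let nv y := - v y.

Lemma bounded_conv_lb f a : 0 <= a -> (forall x, D x -> `|f x| <= M) ->
  conv_lb f a D.
Proof.
move=> a0 fM x; exists (- M) => y Dy.
have := fM y Dy; rewrite ler_norml => /andP[h _].
by rewrite -[leLHS]addr0 lerD// mulr_ge0// dot_ge0.
Qed.

Let lbu : conv_lb u c D. Proof. by apply: bounded_conv_lb => //; exact: ltW. Qed.
Let nvM x : D x -> `|nv x| <= M. Proof. by rewrite normrN; exact: vM. Qed.
Let lbv : conv_lb nv c D. Proof. by apply: bounded_conv_lb => //; exact: ltW. Qed.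
Let lbV : conv_lb nv (c / 2) D.
Proof. by apply: bounded_conv_lb => //; rewrite divr_ge0// ltW. Qed.

Definition upper_env x : R := infconv u c D x.
Definition lower_env x : R := - infconv nv c D x.
Let V x : R := - infconv nv (c / 2) D x.
(* [- infconv (- v) (c / 2)] equals the sup-convolution with parameter [c] of
   [lower_env], so [middle_env] is the infimum of the paraboloids of opening [c]
   lying above [lower_env]. *)
Definition middle_env x : R := infconv V c setT x.

Let VE y z : D z -> v z - c / 2 * dot (y - z) (y - z) <= V y.
Proof. by move=> Dz; have := infconv_le y lbV Dz; rewrite /V /nv; lra. Qed.

Let lower_le_V x y : lower_env x <= V y + c * dot (x - y) (x - y).
Proof.
rewrite /lower_env lerNl; apply: le_infconv => // z Dz.
have := VE y Dz; have := dot_sub_le y x z; rewrite (dot_subC y x) /nv => h1 h2.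
have : c / 2 * dot (y - z) (y - z) <=
    c / 2 * (2 * dot (x - y) (x - y) + 2 * dot (x - z) (x - z)).
  by rewrite ler_wpM2l// divr_ge0// ltW.
by lra.
Qed.

Let lbW : conv_lb V c setT.
Proof. by move=> x; exists (lower_env x) => y _. Qed.

Lemma lower_le_middle x : lower_env x <= middle_env x.
Proof. by apply: le_infconv => //; exists 0. Qed.

(** For [y] in [D], the paraboloid [u y + c |x - y|^2 - p.x - a] has opening [c], vertex
    [Y = y + p / (2c)], and lies above [lower_env]. It is therefore one of the paraboloids whose
    infimum is [middle_env]. *)
Lemma middle_le_upper p a :
  (forall x, lower_env x <= upper_env x - dot p x - a) ->
  forall x, middle_env x <= upper_env x - dot p x - a.
Proof.
move=> con x; rewrite -addrA -lerBlDr; apply: le_infconv => // y Dy.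
have [Y YE] : exists Y, Y = y + (2 * c)^-1 *: p by exists (y + (2 * c)^-1 *: p).
have sq t : c * dot (t - y) (t - y) - dot p t =
    c * dot (t - Y) (t - Y) + (c * dot y y - c * dot Y Y).
  rewrite !dotE (dotC y t) (dotC Y t).
  have -> : dot t Y = dot t y + (2 * c)^-1 * dot p t by rewrite YE !dotE (dotC t p).
  by field; rewrite gt_eqF.
have VY : V Y <= u y + (c * dot y y - c * dot Y Y) - a.
  rewrite /V lerNl; apply: le_infconv => // z Dz; rewrite /nv.
  (* The midpoint minimises [c |t - z|^2 + c |t - Y|^2], with value [c / 2 |Y - z|^2], the penalty
     occurring in [V Y]. *)
  pose t := 2^-1 *: (z + Y).
  have h1 := con t; have h2 := infconv_le t lbu Dy; have h3 := infconv_le t lbv Dz.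
  rewrite -/(upper_env t) in h2.
  have e1 : dot (t - z) (t - z) = dot (Y - z) (Y - z) / 4.
    by rewrite /t !dotE (dotC Y z); field.
  have e2 : dot (t - Y) (t - Y) = dot (Y - z) (Y - z) / 4.
    by rewrite /t !dotE (dotC Y z); field.
  have := sq t; rewrite e2; rewrite e1 /nv in h3; rewrite /lower_env in h1.
  by lra.
have h := infconv_le x lbW (I : setT Y); rewrite -/(middle_env x) in h.
by have := sq x; lra.
Qed.

Let V_semiconvex x y s : 0 <= s <= 1 ->
  V (s *: x + (1 - s) *: y) <= s * V x + (1 - s) * V y +
    c / 2 * (s * (1 - s)) * dot (x - y) (x - y).
Proof. by move=> s01; have := infconv_semiconcave x y lbV D0 s01; rewrite /V; lra. Qed.

(** The lower bound is semiconcavity of an infimal convolution. For the upper one, near-optimal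
    points [y1], [y2] are interpolated: [V] is semiconvex with constant [c / 2], and [c / 2 |y1 -
    y2|^2 <= c |x - y|^2 + c |k|^2], where the [k] term is cancelled by the strict convexity of the
    penalty. *)
Lemma middle_two_sided : two_sided c middle_env.
Proof.
move=> x y s s01; have /andP[s0 s1] := s01.
have s1' : 0 <= 1 - s by rewrite subr_ge0.
rewrite ler_norml; apply/andP; split.
  have := @infconv_semiconcave V c setT x y s lbW (ex_intro _ 0 I) s01.
  by rewrite -/(middle_env _); lra.
set m := s *: x + (1 - s) *: y.
apply/ler_addgt0Pr => e e0.
have [y1 _ h1] := infconv_near x lbW (ex_intro _ 0 I) e0.
have [y2 _ h2] := infconv_near y lbW (ex_intro _ 0 I) e0.
rewrite -/(middle_env _) in h1; rewrite -/(middle_env _) in h2.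
pose Y := s *: y1 + (1 - s) *: y2.
have h3 := infconv_le m lbW (I : setT Y); rewrite -/(middle_env m) in h3.
have h4 := V_semiconvex y1 y2 s01; rewrite -/Y in h4.
have m1 : s * (V y1 + c * dot (x - y1) (x - y1)) <= s * (middle_env x + e).
  by rewrite ler_wpM2l// ltW.
have m2 : (1 - s) * (V y2 + c * dot (y - y2) (y - y2)) <= (1 - s) * (middle_env y + e).
  by rewrite ler_wpM2l// ltW.
have e1 : m - Y = s *: (x - y1) + (1 - s) *: (y - y2).
  by rewrite /m /Y !scalerBr opprD addrACA.
rewrite e1 dot_convex in h3.
pose k := (x - y1) - (y - y2).
have e2 : y1 - y2 = (x - y) - k.
  by apply/rowP => i; rewrite /k !mxE; ring.
have h5 : dot (y1 - y2) (y1 - y2) <= 2 * dot (x - y) (x - y) + 2 * dot k k.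
  by rewrite e2; have := dot_add_le (x - y) (- k); rewrite dotNl dotNr opprK.
rewrite -/k in h3.
have h6 : c / 2 * (s * (1 - s)) * dot (y1 - y2) (y1 - y2) <=
    c / 2 * (s * (1 - s)) * (2 * dot (x - y) (x - y) + 2 * dot k k).
  by rewrite ler_wpM2l// !mulr_ge0// ltW.
by lra.
Qed.

Lemma gap_semiconcave x z : let f t := upper_env t - lower_env t in
  f z + f (x *+ 2 - z) - 2 * f x <= 4 * c * dot (z - x) (z - x).
Proof.
have hs : 0 <= (2^-1 : R) <= 1 by apply/andP; split; lra.
have e2 : 1 - 2^-1 = 2^-1 :> R by field.
have h1 := infconv_semiconcave z (x *+ 2 - z) lbu D0 hs.
have h2 := infconv_semiconcave z (x *+ 2 - z) lbv D0 hs.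
have em : 2^-1 *: z + 2^-1 *: (x *+ 2 - z) = x.
  by rewrite -scalerDr addrC subrK -[x *+ 2]scaler_nat scalerA mulVf// scale1r.
have ed : z - (x *+ 2 - z) = 2 *: (z - x).
  by apply/rowP => i; rewrite !mxE; ring.
rewrite e2 em ed !dotZl !dotZr in h1 h2.
by rewrite /= /upper_env /lower_env; lra.
Qed.

(** Near-minimality at [x] and semiconcavity bound [f] from above by a paraboloid of slope [p],
    near-minimality at [y] bounds it from below with slope [q]. They are compared at [y + s]; the
    step [s = (q - p) / (16 c)] maximises the resulting [(q - p).s - 8 c |s|^2]. *)
Lemma contact_separation x y p q e :
  let f t := upper_env t - lower_env t in
  (forall t, f x - dot p x - e <= f t - dot p t) ->
  (forall t, f y - dot q y - e <= f t - dot q t) ->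
  dot (q - p) (q - p) <= 32 * c * (8 * c * dot (y - x) (y - x) + 3 * e).
Proof.
move=> f cx cy.
pose s := (16 * c)^-1 *: (q - p); pose z := y + s.
have h1 := gap_semiconcave x z; rewrite /= -!/(f _) in h1.
have h2 := cx (x *+ 2 - z); have h3 := cx y; have h4 := cy z.
have e1 : dot p (x *+ 2 - z) = 2 * dot p x - dot p z.
  by rewrite [x *+ 2]mulr2n !dotE; ring.
rewrite e1 in h2.
have h5 : dot (z - x) (z - x) <= 2 * dot (y - x) (y - x) + 2 * dot s s.
  by rewrite (_ : z - x = (y - x) + s) ?dot_add_le// /z addrAC.
have h6 : 4 * c * dot (z - x) (z - x) <=
  4 * c * (2 * dot (y - x) (y - x) + 2 * dot s s).
  by rewrite ler_wpM2l// mulr_ge0// ltW.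
have h7 : dot (q - p) s <= 8 * c * dot (y - x) (y - x) + 8 * c * dot s s + 3 * e.
  have : dot (q - p) s = (dot q z - dot q y) - (dot p z - dot p y).
    by rewrite /z !dotE; ring.
  by lra.
move: h7; rewrite /s !dotZr !dotZl; set Q := dot (q - p) (q - p).
set X := dot (y - x) _ => h7.
have e3 : 8 * c * ((16 * c)^-1 * ((16 * c)^-1 * Q)) = (32 * c)^-1 * Q.
  by field; rewrite gt_eqF.
have e4 : (16 * c)^-1 * Q = 2 * ((32 * c)^-1 * Q).
  by field; rewrite gt_eqF.
rewrite e3 e4 in h7.
have : (32 * c)^-1 * Q <= 8 * c * X + 3 * e by lra.
by rewrite mulrC ler_pdivrMr ?mulr_gt0// mulrC.
Qed.

End Regularisation.
End Convolution.

(** * Semicontinuity and touching *)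

(** Without a minimum, each [x] in [K] has a [y] in [K] with [f y] below [f] near [x]. Compactness,
    along the filter [G] of sublevel sets, then gives a point of [K] strictly below every point of
    [K], itself included. *)
Lemma lsc_compact_min (R : realType) (T : topologicalType) (K : set T) (f : T -> R) :
  K !=set0 -> compact K ->
  (forall x a, K x -> a < f x -> \forall y \near x, K y -> a < f y) ->
  exists2 x, K x & forall y, K y -> f x <= f y.
Proof.
move=> [x0 Kx0] /compact_near_coveringP cK lsc; apply: contrapT => nmin.
have below x : K x -> exists2 y, K y & f y < f x.
  move=> Kx; apply: contrapT => h; apply: nmin; exists x => // y Ky.
  by rewrite leNgt; apply/negP => yx; apply: h; exists y.
pose G := filter_from K (fun a => [set y | K y /\ f y <= f a]).
have GF : Filter G.
  apply: filter_from_filter; first by exists x0.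
  move=> i j Ki Kj; have [ij|ji] := leP (f i) (f j).
    by exists i => // y [Ky yi]; split; split => //; exact: le_trans ij.
  by exists j => // y [Ky yj]; split; split => //; exact: le_trans (ltW ji).
have := cK T G (fun y x => K x -> f y < f x) GF.
have hx x : K x -> \forall x' \near x & i \near G, K x' -> f i < f x'.
  move=> Kx; have [y Ky yx] := below x Kx.
  exists ([set x' | K x' -> f y < f x'], [set i | K i /\ f i <= f y]).
    by split => /=; [exact: lsc|exists y].
  by move=> [x' i] /= [h [Ki iy]] Kx'; apply: le_lt_trans iy (h Kx').
move=> /(_ hx) [a Ka /(_ a)] h.
by have := h (conj Ka (lexx _)) a Ka Ka; rewrite ltxx.
Qed.

Section DotTopology.
Variables (R : realType) (n : nat).
Notation E := 'rV[R]_n.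
Implicit Types (x y b : E).

Lemma coord_le_norm x i : `|x 0 i| <= `|x|.
Proof.
rewrite [leRHS]/Num.norm/= mx_normrE.
by apply: (le_trans _ (le_bigmax _ _ (0, i))).
Qed.

Lemma norm_lt_coord x r : 0 < r -> (forall i, `|x 0 i| < r) -> `|x| < r.
Proof.
move=> r0 xr; rewrite /Num.norm/= mx_normrE.
by apply/bigmax_ltP; split => // -[i j] _; rewrite (ord1 i).
Qed.

Lemma nbhs_dotP x (A : set E) : nbhs x A <->
  exists2 r, 0 < r & forall y, dot (y - x) (y - x) < r -> A y.
Proof.
split=> [/nbhs_normP[e /= e0 xA]|[r r0 rA]].
  exists (e ^+ 2); first by rewrite exprn_gt0.
  move=> y yx; apply: xA => /=; apply: norm_lt_coord => // i.
  have := le_lt_trans (coord_le_dot (y - x) i) yx.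
  rewrite -[ltLHS](real_normK (num_real _)) ltr_pXn2r ?nnegrE ?(ltW e0)//.
  by rewrite !mxE distrC.
pose e := Num.min 1 (r / n.+1%:R).
have e0 : 0 < e by rewrite lt_min ltr01 divr_gt0.
apply/(nbhs_normP x A); exists e => //= y /= yx; apply: rA.
have ye i : `|(y - x) 0 i| <= e.
  by rewrite (le_trans (coord_le_norm _ i))// distrC ltW.
have := dot_le_coord (ltW e0) ye => h; apply: le_lt_trans h _.
have e1 : e ^+ 2 <= e by rewrite expr2 ler_piMl ?(ltW e0)// ge_min lexx.
apply: (@le_lt_trans _ _ (n%:R * (r / n.+1%:R))).
  by rewrite ler_wpM2l// (le_trans e1)// ge_min lexx orbT.
by rewrite mulrA ltr_pdivrMr// mulrC ltr_pM2l// ltr_nat.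
Qed.

Lemma continuous_coord i : continuous (fun x : E => x 0 i).
Proof. exact: coord_continuous. Qed.

Lemma continuous_sum (T : topologicalType) (I : finType) (F : I -> T -> R) :
  (forall i, continuous (F i)) -> continuous (fun t => \sum_i F i t).
Proof. by move=> cF; apply: continuous_big => //; exact: add_continuous. Qed.

Lemma continuous_dot (T : topologicalType) (f g : T -> E) :
  continuous f -> continuous g -> continuous (fun t => dot (f t) (g t)).
Proof.
move=> cf cg; apply: continuous_sum => i t.
apply: cvgM.
  exact: (continuous_comp (cf t) (@coord_continuous _ _ _ 0 i (f t))).
exact: (continuous_comp (cg t) (@coord_continuous _ _ _ 0 i (g t))).
Qed.

Definition dball b (r : R) : set E := [set x | dot (x - b) (x - b) <= r ^+ 2].

Lemma compact_dball b r : compact (dball b r).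
Proof.
apply: bounded_closed_compact.
  exists (`|b| + `|r|); split; first exact: num_real.
  move=> M hM x xb /=; apply: le_trans (ltW hM).
  rewrite -[x](subrK b) addrC (le_trans (ler_normD _ _))// lerD2l.
  rewrite [leLHS]/Num.norm/= mx_normrE; apply/bigmax_leP; split => // -[i j] _ /=.
  rewrite (ord1 i) -ler_sqr ?nnegrE// !real_normK ?num_real//.
  exact: le_trans (coord_le_dot _ _) xb.
have -> : dball b r = (fun x => dot (x - b) (x - b)) @^-1` [set t | t <= r ^+ 2] by [].
apply: closed_comp; last exact: closed_le.
have cs : continuous (fun x : E => x - b).
  by move=> y; apply: continuousB; [exact: cvg_id|exact: cst_continuous].
by move=> x _; exact: (continuous_dot cs cs).
Qed.

Lemma continuous_quad c (g : E) H : continuous (quad c g H).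
Proof.
have cH : continuous (fun x : E => dot (x *m H) x).
  have -> : (fun x : E => dot (x *m H) x) =
      fun x => \sum_i (\sum_k x 0 k * H k i) * x 0 i.
    by apply/funext => x; apply: eq_bigr => i _; rewrite mxE.
  have cS i : continuous (fun x : E => \sum_k x 0 k * H k i).
    apply: continuous_sum => k y.
    exact: (cvgM (@continuous_coord k y) (cvg_cst _)).
  apply: continuous_sum => i x.
  exact: (cvgM (@cS i x) (@continuous_coord i x)).
have cg : continuous (fun x : E => dot g x).
  by apply: continuous_dot; [exact: cst_continuous|move=> x; exact: cvg_id].
have c1 : continuous (fun x : E => c + dot g x).
  by move=> x; exact: (cvgD (cvg_cst c) (cg x)).
have c2 : continuous (fun x : E => dot (x *m H) x / 2).
  by move=> x; refine (cvgM (cH x) (cvg_cst (2^-1 : R))).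
by move=> x; exact: (cvgD (c1 x) (c2 x)).
Qed.

End DotTopology.

Section Touching.
Variables (R : realType) (n : nat).
Notation E := 'rV[R]_n.
Implicit Types (u v f : E -> R) (x y z b : E) (D Di : set E).

Definition lsc_on D f := forall x a, D x -> a < f x ->
  \forall y \near x, D y -> a < f y.

Definition usc_on D f := lsc_on D (fun y => - f y).

(** Minimise [f y + c |x - y|^2 - Q x] jointly over the ball and [D]; the condition on the sphere
    puts [x1] inside. Moving [x1] and [y1] by the same [t] does not change the penalty, so [f] is
    touched at [y1] by a translate of [Q]. *)
Lemma infconv_touch f c D (Q : E -> R) x0 s :
  D !=set0 -> compact D -> lsc_on D f -> conv_lb f c D -> continuous Q ->
  0 < s ->
  (forall x, dot (x - x0) (x - x0) = s ^+ 2 ->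
    infconv f c D x0 - Q x0 < infconv f c D x - Q x) ->
  exists x1 y1, [/\ dot (x1 - x0) (x1 - x0) < s ^+ 2, D y1,
    f y1 + c * dot (x1 - y1) (x1 - y1) <= infconv f c D x1 &
    exists2 r, 0 < r & forall t, dot t t < r -> D (y1 + t) ->
      f y1 - Q x1 <= f (y1 + t) - Q (x1 + t)].
Proof.
move=> D0 cD lf lb cQ s0 bd.
have cK := compact_setX (@compact_dball R n x0 s) cD.
pose G (t : E * E) := c * dot (t.1 - t.2) (t.1 - t.2) - Q t.1.
have cG : continuous G.
  have c12 : continuous (fun t : E * E => t.1 - t.2).
    by move=> t; refine (cvgB (cvg_fst) (cvg_snd)).
  have cd := continuous_dot c12 c12.
  have cQ1 : continuous (fun t : E * E => Q t.1).
    by move=> t; refine (continuous_comp (cvg_fst) (cQ _)).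
  have c1 : continuous (fun t : E * E => c * dot (t.1 - t.2) (t.1 - t.2)).
    by move=> t; refine (cvgM (cvg_cst c) (cd t)).
  by move=> t; refine (cvgB (c1 t) (cQ1 t)).
have [y0 Dy0] := D0.
have x0b : dball x0 s x0 by rewrite /dball/= subrr dot0l sqr_ge0.
have K0 : (dball x0 s `*` D) !=set0 by exists (x0, y0).
have [|[x1 y1] [/= x1b Dy1] tmin] := @lsc_compact_min R _ _ (fun t => f t.2 + G t) K0 cK.
  move=> x a [_ /= Dx] ax.
  pose e := (f x.2 + G x - a) / 2.
  have e0 : 0 < e by rewrite divr_gt0// subr_gt0.
  have h1 : \forall t \near x, D t.2 -> f x.2 - e < f t.2.
    have := lf x.2 (f x.2 - e) Dx; rewrite ltrBlDr ltrDl => /(_ e0) h.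
    exact: (cvg_snd h).
  have h2 : \forall t \near x, G x - e < G t.
    by apply: (cvgr_gt (G x) (cG x)); rewrite ltrBlDr ltrDl.
  near=> t => -[_ /= Dt].
  have p1 : f x.2 - e < f t.2 by (have : D t.2 by []); near: t.
  have p2 : G x - e < G t by near: t.
  by rewrite /e in p1 p2 *; lra.
have m0 : f y1 + G (x1, y1) <= infconv f c D x0 - Q x0.
  rewrite lerBrDr; apply: le_infconv => // y Dy.
  by have := tmin (x0, y) (conj x0b Dy); rewrite /G /=; lra.
have m1 : f y1 + c * dot (x1 - y1) (x1 - y1) <= infconv f c D x1.
  apply: le_infconv => // y Dy.
  by have := tmin (x1, y) (conj x1b Dy); rewrite /G /=; lra.
have sx1 : dot (x1 - x0) (x1 - x0) < s ^+ 2.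
  rewrite lt_neqAle x1b andbT; apply/eqP => /bd.
  have := infconv_le x1 lb Dy1; move: m0; rewrite /G/=; lra.
exists x1, y1; split => //.
have near1 : \forall x \near x1, dot (x - x0) (x - x0) < s ^+ 2.
  have cs : continuous (fun x : E => x - x0).
    by move=> y; apply: continuousB; [exact: cvg_id|exact: cst_continuous].
  by apply: (cvgr_lt (dot (x1 - x0) (x1 - x0)) (continuous_dot cs cs (x := x1))).
have /nbhs_dotP[r r0 hr] := near1.
exists r => // t tr Dt.
have := hr (x1 + t); rewrite (addrC x1) addrK => /(_ tr)/ltW tb.
have := tmin (t + x1, y1 + t) (conj tb Dt); rewrite /G/= (addrC t).
by rewrite opprD addrACA subrr addr0; lra.
Unshelve. all: by end_near. Qed.

Section NearMinimizers.
Variables (u v : E -> R) (D Di : set E).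
Hypotheses (cD : compact D) (oDi : forall x, Di x -> \forall y \near x, Di y).
Hypotheses (lu : lsc_on D u) (lv : usc_on D v).
Hypothesis bd : forall x, D x -> ~ Di x -> v x < u x.

(** At a point of [D] outside [Di], semicontinuity keeps [u y - v z] above a third of the positive
    gap for all [y], [z] nearby; compactness makes this uniform. *)
Let near_diagonal : exists2 k : R, 0 < k < 1 & forall y z, D y -> D z ->
  dot (y - z) (y - z) < k -> u y - v z <= k -> Di y /\ Di z.
Proof.
pose P (k : R) y := D y -> forall z, D z ->
  dot (y - z) (y - z) < k -> u y - v z <= k -> Di y /\ Di z.
have h : \forall k \near (0:R)^'+, D `<=` P k.
  have /compact_near_coveringP cov := cD; apply: cov => x Dx.
  have [e e0 [A xA hA]] : exists2 e : R, 0 < e & exists2 A, nbhs x A &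
      forall y z, A y -> A z -> D y -> D z -> u y - v z <= e -> Di y /\ Di z.
    have [xi|xi] := pselect (Di x).
      exists 1 => //; exists Di; first exact: oDi.
      by [].
    pose e := (u x - v x) / 3.
    have e0 : 0 < e by rewrite divr_gt0// subr_gt0 bd.
    exists e => //.
    exists [set y | (D y -> u x - e < u y) /\ (D y -> - v x - e < - v y)].
      have h1 := lu (x := x) (a := u x - e) Dx.
      have h2 := lv (x := x) (a := - v x - e) Dx.
      by apply: filterI; [apply: h1|apply: h2]; rewrite ltrBlDr ltrDl.
    move=> y z [h1 _] [_ h2] Dy Dz h3.
    by have := h1 Dy; have := h2 Dz; rewrite /e in h3 *; lra.
  have /nbhs_dotP[r r0 rA] := xA.
  exists ([set y | dot (y - x) (y - x) < r / 4], [set k | k < Num.min e (r / 4)]).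
    split => /=.
      by apply/nbhs_dotP; exists (r / 4) => //; rewrite divr_gt0.
    by apply: nbhs_right_lt; rewrite lt_min e0 divr_gt0.
  move=> [y k] [/= yx]; rewrite lt_min => /andP[ke kr] Dy z Dz yz uv.
  apply: hA => //; last exact: le_trans uv (ltW ke).
    by apply: rA; lra.
  apply: rA; have := dot_sub_le z y x; rewrite (dot_subC z y); lra.
have [k [[hk k0] k1]] : exists k : R, (D `<=` P k /\ 0 < k) /\ k < 1.
  near (0:R)^'+ => k; exists k; split; last by near: k; exact: nbhs_right_lt.
  by split; near: k => //; exact: nbhs_right_gt.
exists k; first by rewrite k0.
by move=> y z Dy Dz; exact: hk.
Unshelve. all: by end_near. Qed.

Variables (b : E) (M B : R).
Hypotheses (uM : forall x, D x -> `|u x| <= M) (vM : forall x, D x -> `|v x| <= M).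
Hypothesis (DB : forall x, D x -> dot (x - b) (x - b) <= B).

Lemma near_minimizers_interior : 0 <= M -> 0 <= B ->
  exists c rho delta : R, [/\ 1 <= c, 0 < rho, 0 < delta &
  forall p x y z : E, (forall i, `|p 0 i| <= rho) -> D y -> D z ->
  u y - v z + c * (dot (x - y) (x - y) + dot (x - z) (x - z)) -
    dot p (x - b) <= delta ->
  [/\ Di y, Di z, u y - v z < 1 &
      dot (x - b) (x - b) <= 4 * (1 + 2 * M) + 2 * B]].
Proof.
move=> M0 B0; have [k /andP[k0 k1] hk] := near_diagonal.
have [N NE] : exists N : R, N = n%:R by exists n%:R.
have nn : 0 <= N by rewrite NE ler0n.
(* As [u] and [v] are bounded by [M], this opening forces [|x - y|^2 + |x - z|^2 < k / 2], hence
   [|y - z|^2 < k]. *)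
pose c := 1 + 4 * (1 + 2 * M) / k.
have c1 : 1 <= c by rewrite lerDl divr_ge0// ?(ltW k0)// mulr_ge0// addr_ge0// mulr_ge0.
have c0 : 0 < c by lra.
(* With slopes at most [rho = k / d], the part of [p.(x - b)] not absorbed by the penalty is at most
   [k / 2]. *)
pose d := 2 * (B + 2 * N + 1).
have d0 : 1 < d by rewrite /d; lra.
pose rho := k / d.
have rho0 : 0 < rho by rewrite divr_gt0//; lra.
have rho1 : rho <= 1 by rewrite ler_pdivrMr; lra.
have rd : rho * (B + 2 * N) <= k / 2.
  have -> : k / 2 = rho * (B + 2 * N + 1).
    by rewrite /rho /d; field; apply/eqP; lra.
  by rewrite ler_pM2l// lerDl.
exists c, rho, (k / 2); split => //; first by rewrite divr_gt0.
move=> p x y z hp Dy Dz h.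
have pp2 : dot p p <= N * rho ^+ 2 by rewrite NE; exact: dot_le_coord (ltW rho0) hp.
have pp : dot p p <= N * rho.
  apply: le_trans pp2 _.
  by rewrite ler_wpM2l// expr2 ler_piMl// ltW.
have c20 : 0 < c / 2 by rewrite divr_gt0.
have y1 := dot_young (x - y) p c20; have y2 := dot_young (y - b) p rho0.
have i1 : (4 * (c / 2))^-1 * dot p p <= N * rho.
  apply: le_trans pp; rewrite ler_piMl ?dot_ge0// invf_le1; lra.
have i2' : dot (y - b) p <= rho * B + N * rho.
  have i3 : (4 * rho)^-1 * dot p p <= N * rho.
    have r4 : 0 < 4 * rho by exact: mulr_gt0.
    rewrite mulrC ler_pdivrMr//; apply: (le_trans pp2).
    rewrite -mulrA ler_wpM2l// expr2 ler_wpM2l ?(ltW rho0)//; lra.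
  have i4 : rho * dot (y - b) (y - b) <= rho * B by rewrite ler_pM2l// DB.
  lra.
have pe : dot p (x - b) = dot (x - y) p + dot (y - b) p.
  by rewrite -dotDl addrA subrK dotC.
have X0 := dot_ge0 (x - y); have Z0 := dot_ge0 (x - z).
have yz := dot_sub_le y x z; rewrite (dot_subC y x) in yz.
have cX : 0 <= c / 2 * dot (x - y) (x - y) by rewrite mulr_ge0// ltW.
have cZ : 0 <= c / 2 * dot (x - z) (x - z) by rewrite mulr_ge0// ltW.
have main : u y - v z + c / 2 * dot (x - y) (x - y) +
    c / 2 * dot (x - z) (x - z) <= k.
  have -> : k = k / 2 + k / 2 by field.
  by rewrite pe in h; lra.
have uv : u y - v z <= k by lra.
have /ler_normlP[um1 um2] := uM Dy; have /ler_normlP[vm1 vm2] := vM Dz.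
have sumb : c / 2 * (dot (x - y) (x - y) + dot (x - z) (x - z)) <= 1 + 2 * M by lra.
have ck : 4 * (1 + 2 * M) < c * k.
  have -> : c * k = k + 4 * (1 + 2 * M) by rewrite /c; field; rewrite gt_eqF.
  by lra.
have sum2 : dot (x - y) (x - y) + dot (x - z) (x - z) < k / 2.
  rewrite -(ltr_pM2l c20); apply: le_lt_trans sumb _.
  by rewrite (_ : c / 2 * (k / 2) = c * k / 4); [lra|field].
have sum3 : dot (x - y) (x - y) <= 2 * (1 + 2 * M).
  have : 2^-1 * (dot (x - y) (x - y) + dot (x - z) (x - z)) <= 1 + 2 * M.
    apply: le_trans sumb; rewrite ler_wpM2r ?addr_ge0//; lra.
  by lra.
have [Dy' Dz'] : Di y /\ Di z by apply: hk => //; lra.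
split => //; first by lra.
have := dot_sub_le x y b; have := DB Dy; lra.
Qed.

End NearMinimizers.
End Touching.

(** * Near-contact points where [w] is almost quadratic *)

Section Contact.
Variables (R : realType) (n : nat).
Notation E := 'rV[R]_n.
Implicit Types (u v f : E -> R) (x y z b p g : E) (D Di : set E) (H : 'M[R]_n).

Lemma quad_bump c g H p x (k : R) : exists c' g', forall y,
  quad c g H y + dot p y + k / 2 * dot (y - x) (y - x) = quad c' g' (H + k%:M) y.
Proof.
exists (c + k / 2 * dot x x), (g + p - k *: x) => y.
rewrite /quad mulmxDr mul_mx_scalar !dotE (dotC y x).
by field.
Qed.

Lemma exists_natexp_ge (x : R) : exists j : nat, x <= 2 ^+ j.
Proof.
have [x0|x0] := leP x 0; first by exists 0%N; rewrite expr0 (le_trans x0).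
exists (Num.truncn x).+1.
have /andP[_ /ltW h] := truncn_itv (ltW x0); apply: le_trans h _.
by rewrite -natrX ler_nat ltnW// ltn_expl.
Qed.

Lemma sqr_natr_sub_ge1 (a b : nat) : a != b -> 1 <= (a%:R - b%:R : R) ^+ 2.
Proof.
wlog ab : a b / (a < b)%N => [h|_].
  rewrite neq_ltn => /orP[ab|ba]; first by apply: h; rewrite ?neq_ltn ab.
  by rewrite -sqrrN opprB; apply: h; rewrite ?neq_ltn ba.
by rewrite -sqrrN opprB exprn_ege1// lerBrDr addrC natr1 ler_nat.
Qed.

Lemma dist_truncn (t : R) : 0 <= t -> `|t - (Num.truncn t)%:R| <= 1.
Proof.
move=> /truncn_itv/andP[h1 h2]; rewrite ger0_norm ?subr_ge0//.
by rewrite lerBlDr addrC natr1 ltW.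
Qed.

Lemma truncn_eq_dist (s t : R) : 0 <= s -> 0 <= t ->
  Num.truncn s = Num.truncn t -> `|s - t| <= 1.
Proof.
move=> /truncn_itv/andP[h1 h2] /truncn_itv/andP[h3 h4] st.
rewrite st in h1 h2; rewrite -natr1 in h2 h4.
by rewrite ler_norml; apply/andP; split; lra.
Qed.

Lemma sqr_le_coord (t r : R) : 0 <= r -> t ^+ 2 <= r ^+ 2 -> `|t| <= r.
Proof. by move=> r0; rewrite -(real_normK (num_real t)) ler_pXn2r ?nnegrE. Qed.

Section Gap.
Variables (u v : E -> R) (D : set E) (c M : R) (b : E).
Hypotheses (c1 : 1 <= c) (Db : D b).
Hypotheses (uM : forall x, D x -> `|u x| <= M) (vM : forall x, D x -> `|v x| <= M).

Let f t := upper_env u D c t - lower_env v D c t.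

Lemma gap_le y z t : D y -> D z ->
  f t <= u y + c * dot (t - y) (t - y) - v z + c * dot (t - z) (t - z).
Proof.
move=> Dy Dz; have c0 : 0 <= c by rewrite (le_trans _ c1).
have vM' x : D x -> `|- v x| <= M by rewrite normrN; exact: vM.
have h1 := infconv_le t (bounded_conv_lb c0 uM) Dy.
have h2 := infconv_le t (bounded_conv_lb c0 vM') Dz.
by rewrite /f /upper_env /lower_env; lra.
Qed.

Lemma gap_inf (B : R) p e : (forall x, D x -> dot (x - b) (x - b) <= B) -> 0 < e ->
  exists x a, (forall t, a <= f t - dot p t) /\ f x - dot p x < a + e.
Proof.
move=> DB e0.
have c0 : 0 < c by rewrite (lt_le_trans _ c1).
have D0 : D !=set0 by exists b.
have vM' x : D x -> `|- v x| <= M by rewrite normrN; exact: vM.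
have lb t : - M - M - (4 * c)^-1 * dot p p - B - 4^-1 * dot p p - dot p b <=
    f t - dot p t.
  have h2 : - M <= - lower_env v D c t.
    rewrite /lower_env opprK; apply: le_infconv => // z Dz.
    have /ler_normlP[_ h] := vM Dz.
    have : 0 <= c * dot (t - z) (t - z) by rewrite mulr_ge0 ?dot_ge0// ltW.
    by lra.
  have h1 : - M + dot p t - (4 * c)^-1 * dot p p - B - 4^-1 * dot p p -
      dot p b <= upper_env u D c t.
    apply: le_infconv => // y Dy.
    have /ler_normlP[h _] := uM Dy.
    have y1 := dot_young (t - y) p c0; have y2 := dot_young (y - b) p ltr01.
    have e1 : dot p t = dot (t - y) p + dot (y - b) p + dot p b.
      by rewrite !dotE !(dotC _ p); ring.
    have := DB _ Dy; rewrite mulr1 in y2; rewrite e1; lra.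
  by rewrite /f; lra.
have hi : has_inf [set f t - dot p t | t in setT].
  by split; [exists (f 0 - dot p 0), 0|eexists => _ [t _ <-]; exact: lb].
have [_ [x _ <-] h] := inf_adherent e0 hi.
exists x, (inf [set f t - dot p t | t in setT]); split=> // t.
by apply: ge_inf; [exact: hi.2|exists t].
Qed.

End Gap.

(* The slopes [sl q] are [A * eta] apart, so the points [xa q] near-minimising
   [f - sl q] lie in different cells of a grid of mesh [eta]: [bet] is injective
   and [regular_scale] applies. *)
Lemma contact_near_quadratic f (w : E -> R) b (c rho delta gam Rb : R) :
  1 <= c -> 0 < rho -> 0 < delta -> 0 < gam -> 0 <= Rb ->
  two_sided c w -> f b <= 0 ->
  (forall p e, 0 < e -> exists x a, (forall t, a <= f t - dot p t) /\
    f x - dot p x < a + e) ->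
  (forall x y p q e, (forall t, f x - dot p x - e <= f t - dot p t) ->
    (forall t, f y - dot q y - e <= f t - dot q t) ->
    dot (q - p) (q - p) <= 32 * c * (8 * c * dot (y - x) (y - x) + 3 * e)) ->
  (forall p x, (forall i, `|p 0 i| <= rho) -> f x - dot p (x - b) <= delta ->
    dot (x - b) (x - b) <= Rb) ->
  exists p x a e r, [/\ (forall i, `|p 0 i| <= rho), 0 < r, c * r ^+ 2 <= delta &
    [/\ 0 < e, e <= delta, e <= gam * r ^+ 2, (forall t, a <= f t - dot p t) &
     f x - dot p x < a + e /\ exists cq g H, H^T = H /\
       forall y, dot (y - x) (y - x) <= (r / 2) ^+ 2 ->
       `|w y - quad cq g H y| <= gam * r ^+ 2]].
Proof.
move=> c1 rho0 delta0 gam0 Rb0 ww2 fb hmin sep loc.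
have c0 : 0 < c by exact: lt_le_trans c1.
have [L L1 hL] := regular_scale n (ltW c0) gam0.
have L0 : 0 < L%:R :> R by rewrite ltr0n ltnW.
have [nn nnE] : exists nn : R, nn = n%:R by exists n%:R.
have nn0 : 0 <= nn by rewrite nnE.
(* Two near-minimisers in one cell would have slopes at squared distance at most [(A - 1) eta^2],
   less than the [(A eta)^2] separating distinct slopes. *)
have [A AE] : exists A : R, A = 1 + 32 * c * (8 * c * nn + 3) by eexists.
have A1 : 1 <= A by rewrite AE lerDl !(mulr_ge0, addr_ge0)// ltW.
have A0 : 0 < A by exact: lt_le_trans A1.
have [eta0 eta0E] : exists eta0 : R, eta0 = rho / A by eexists.
have eta00 : 0 < eta0 by rewrite eta0E divr_gt0.
have [R1 R1E] : exists R1 : R, R1 = Rb + 1 by eexists.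
have R11 : 1 <= R1 by rewrite R1E lerDr.
have R10 : 0 <= R1 by exact: le_trans R11.
have RR : Rb <= R1 ^+ 2.
  by rewrite R1E sqrrD1; clear -Rb0; have := sqr_ge0 Rb; lra.
pose Bn := ((Num.truncn (2 * R1 / eta0)).+1 + L)%N.
have hBn : 2 * R1 / eta0 + L%:R <= Bn%:R.
  have h0 : 0 <= 2 * R1 / eta0 by rewrite divr_ge0 ?(ltW eta00)// mulr_ge0.
  by have /andP[_ /ltW h] := truncn_itv h0; rewrite natrD lerD2r.
have [t0 [t00 t01 ct0]] : exists t0 : R, [/\ 0 < t0, t0 <= 1 & c * t0 <= delta].
  exists (Num.min 1 (delta / c)); split.
  - by rewrite lt_min ltr01 !divr_gt0.
  - by rewrite ge_min lexx.
  - by rewrite mulrC -ler_pdivlMr// ge_min lexx orbT.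
(* Since [k + j0 < N], this gives [r <= t0], and so [c * r ^+ 2 <= delta]. *)
have [j0 hj0] := exists_natexp_ge (L%:R * eta0 / t0).
have [N hN] := hL Bn j0.
have N20 : 0 < 2 ^+ N :> R by rewrite exprn_gt0.
have [eta etaE] : exists eta : R, eta = eta0 / 2 ^+ N by eexists.
have eta_gt0 : 0 < eta by rewrite etaE divr_gt0.
have eta2 : 0 < eta ^+ 2 by rewrite exprn_gt0.
(* The tolerance is fixed after [eta]: [eta ^+ 2] serves the separation of slopes, [gam * eta ^+ 2]
   is below [gam * r ^+ 2]. *)
have [e [e0 e1 e2 e3]] : exists e : R, [/\ 0 < e, e <= delta, e <= eta ^+ 2 &
    e <= gam * eta ^+ 2].
  exists (Num.min delta (Num.min (eta ^+ 2) (gam * eta ^+ 2))); split.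
  - by rewrite !lt_min delta0 eta2 mulr_gt0.
  - by rewrite ge_min lexx.
  - by rewrite !ge_min lexx orbT.
  - by rewrite !ge_min lexx !orbT.
have Ae : 0 < A * eta by exact: mulr_gt0.
pose sl (q : {ffun 'I_n -> 'I_(2 ^ N)}) : E := \row_i (A * eta * (q i)%:R).
have slb q i : `|sl q 0 i| <= rho.
  rewrite mxE ger0_norm ?(mulr_ge0 (ltW Ae))//.
  have -> : rho = A * eta * 2 ^+ N.
    by rewrite etaE eta0E; field; rewrite !gt_eqF.
  by rewrite ler_pM2l// -natrX ler_nat ltnW.
have [xa hxa] := choice (fun q => hmin (sl q) e e0).
have [aa haa] := choice hxa.
have xb q i : `|(xa q - b) 0 i| <= R1.
  have [h1 h2] := haa q; apply: sqr_le_coord => //.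
  apply: le_trans (coord_le_dot _ i) _; apply: le_trans RR.
  apply: (loc (sl q)) => //; rewrite dotDr dotNr.
  by have := h1 b; clear -h2 e1 fb; lra.
(* The corner leaves a margin of [L * 2 ^ N] cells below the region containing the [xa q], as
   [regular_scale] requires. *)
pose o : E := \row_i (b 0 i - R1 - L%:R * eta0).
pose tt q i := (xa q 0 i - o 0 i) / eta.
have ttE q i : tt q i = ((xa q - b) 0 i + R1) / eta + L%:R * 2 ^+ N.
  by rewrite /tt /o !mxE etaE; field; rewrite !gt_eqF.
have tt1 q i : L%:R * 2 ^+ N <= tt q i.
  rewrite ttE lerDr divr_ge0 ?(ltW eta_gt0)//.
  by have /ler_normlP[h _] := xb q i; rewrite -lerBlDr sub0r lerNl.
have tt2 q i : tt q i <= Bn%:R * 2 ^+ N.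
  rewrite ttE; apply: le_trans (_ : (2 * R1 / eta0 + L%:R) * 2 ^+ N <= _); last first.
    by rewrite ler_pM2r.
  rewrite [leRHS]mulrDl lerD2r etaE invf_div [leLHS]mulrA [leRHS]mulrAC.
  rewrite ler_pM2r ?invr_gt0// ler_pM2r//.
  by have /ler_normlP[_ h] := xb q i; rewrite mulr_natl mulr2n lerD2r.
have tt0 q i : 0 <= tt q i by rewrite (le_trans _ (tt1 q i))// mulr_ge0// ltW.
pose bet q i := Num.truncn (tt q i).
have betB q i : (L * 2 ^ N <= bet q i <= Bn * 2 ^ N)%N.
  have /andP[h1 h2] := truncn_itv (tt0 q i); apply/andP; split.
    by rewrite /bet truncn_ge_nat// natrM natrX.
  by rewrite -(ler_nat R) natrM natrX (le_trans h1).
have xaE q i : xa q 0 i = o 0 i + eta * tt q i.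
  by rewrite /tt mulrC divfK ?gt_eqF// addrC subrK.
have betI : injective bet.
  move=> q1 q2 qq; apply: contrapT => ne.
  have [i qi] : exists i, q1 i <> q2 i.
    apply: contrapT => /forallNP h; apply: ne; apply/ffunP => i.
    by apply: contrapT; exact: h.
  have hx : dot (xa q2 - xa q1) (xa q2 - xa q1) <= nn * eta ^+ 2.
    rewrite nnE; apply: dot_le_coord; first exact: ltW.
    move=> k; rewrite !mxE !xaE opprD addrACA subrr add0r -mulrBr normrM gtr0_norm//.
    rewrite ler_piMr ?(ltW eta_gt0)// truncn_eq_dist//.
    by have /(congr1 (fun h => h k)) := qq.
  have [h1 h2] := haa q1; have [h3 h4] := haa q2.
  have hs : dot (sl q2 - sl q1) (sl q2 - sl q1) <=
      32 * c * (8 * c * dot (xa q2 - xa q1) (xa q2 - xa q1) + 3 * e).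
    apply: sep => t; rewrite lerBlDr.
      by apply: le_trans (ltW h2) _; rewrite lerD2r.
    by apply: le_trans (ltW h4) _; rewrite lerD2r.
  have lo : (A * eta) ^+ 2 <= dot (sl q2 - sl q1) (sl q2 - sl q1).
    apply: le_trans (coord_le_dot _ i); rewrite !mxE -mulrBr [leRHS]exprMn.
    rewrite ler_peMr ?sqr_ge0//.
    by apply: sqr_natr_sub_ge1; apply/eqP => h; apply: qi; apply: val_inj.
  have up : 32 * c * (8 * c * dot (xa q2 - xa q1) (xa q2 - xa q1) + 3 * e) <=
      32 * c * (8 * c * (nn * eta ^+ 2) + 3 * eta ^+ 2).
    rewrite ler_pM2l ?mulr_gt0//; apply: lerD; last by rewrite ler_pM2l.
    by rewrite ler_pM2l ?mulr_gt0.
  have AA : (A - 1) * eta ^+ 2 = 32 * c * (8 * c * (nn * eta ^+ 2) + 3 * eta ^+ 2).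
    by rewrite AE; ring.
  have A2 : A * eta ^+ 2 <= (A * eta) ^+ 2.
    by rewrite exprMn ler_pM2r// expr2 ler_peMl// ltW.
  have := le_trans lo (le_trans hs up); rewrite -AA => /(le_trans A2).
  by rewrite mulrBl mul1r lerBrDr gerDl leNgt eta2.
have [k [q [cq [g [H [kN Hs hq]]]]]] := hN w eta o bet ww2 eta_gt0 betI betB.
have [r rE] : exists r, r = L%:R * (2 ^+ k * eta) by eexists.
rewrite /= -rE in hq.
have k0 : 0 < 2 ^+ k :> R by rewrite exprn_gt0.
(* The grid point of [xa q] is within [eta <= r / 2] in each coordinate, so the ball of radius
   [r / 2] about [xa q] lies in the cube of half-side [r] about it. *)
have eta_r : 2 * eta <= r.
  rewrite rE; apply: ler_pM => //; [exact: ltW|by rewrite ler_nat|].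
  by rewrite ler_peMl ?(ltW eta_gt0)// exprn_ege1// ler1n.
have r0 : 0 < r by apply: lt_le_trans eta_r; rewrite mulr_gt0.
have rt : r <= t0.
  have h2 : 2 ^+ k * 2 ^+ j0 <= 2 ^+ N :> R.
    by rewrite -exprD ler_eXn2l ?ltr1n// ltnW.
  rewrite ler_pdivrMr// in hj0.
  have -> : r = 2 ^+ k * (L%:R * eta0) / 2 ^+ N.
    by rewrite rE etaE; field; rewrite gt_eqF.
  rewrite ler_pdivrMr//; apply: (@le_trans _ _ (2 ^+ k * (2 ^+ j0 * t0))).
    by rewrite ler_pM2l.
  by rewrite mulrA [leRHS]mulrC ler_pM2r.
have cr : c * r ^+ 2 <= delta.
  apply: le_trans ct0; rewrite ler_pM2l// expr2.
  by rewrite (le_trans _ rt)// ler_piMl ?(ltW r0)// (le_trans rt).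
have [a_le xp_e] := haa q.
exists (sl q), (xa q), (aa q), e, r; split => //; split => //.
  apply: le_trans e3 _; rewrite ler_pM2l// lerXn2r ?nnegrE ?(ltW r0) ?(ltW eta_gt0)//.
  by apply: le_trans eta_r; rewrite ler_peMl ?(ltW eta_gt0)// ler1n.
split => //; exists cq, g, H; split => // y hy; apply: hq => i.
have h1 : `|(y - xa q) 0 i| <= r / 2.
  apply: sqr_le_coord; first by rewrite divr_ge0 ?(ltW r0).
  exact: le_trans (coord_le_dot _ i) hy.
have h2 : `|(xa q - latt o eta (bet q)) 0 i| <= eta.
  rewrite /latt !mxE xaE !mxE opprD addrACA subrr add0r -mulrBr.
  by rewrite normrM gtr0_norm// ler_piMr ?(ltW eta_gt0)// dist_truncn.
have -> : (y - latt o eta (bet q)) 0 i =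
    (y - xa q) 0 i + (xa q - latt o eta (bet q)) 0 i.
  by rewrite -(subrKA (xa q)) mxE.
apply: (le_trans (ler_normD _ _)); apply: (le_trans (lerD h1 h2)).
by clear -eta_r; lra.
Qed.

End Contact.

(** * The second-order contradiction *)

Section Key.
Variables (R : realType) (n : nat).
Notation E := 'rV[R]_n.
Implicit Types (u v : E -> R) (x y z b g t : E) (D Di : set E) (H : 'M[R]_n).

(** [Pu] and [Pv] stand for the viscosity inequalities, so that [F] enters only through [gap]. The
    bound [u y - v z < 1] handed to the tests later shows that truncated functions agree with the
    original ones there. *)
Lemma touching_contradiction u v D Di b (M B K : R) (Pu Pv : 'M[R]_n -> Prop) :
  compact D -> D b -> (forall x, Di x -> D x) ->
  (forall x, Di x -> \forall y \near x, Di y) ->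
  lsc_on D u -> usc_on D v ->
  (forall x, D x -> ~ Di x -> v x < u x) -> u b <= v b ->
  (forall x, D x -> `|u x| <= M) -> (forall x, D x -> `|v x| <= M) ->
  (forall x, D x -> dot (x - b) (x - b) <= B) ->
  0 < K ->
  (forall H, H^T = H -> Pv (H + K%:M) -> Pu (H - K%:M) -> False) ->
  (forall y z g H r, Di y -> D z -> u y - v z < 1 -> H^T = H -> 0 < r ->
    (forall t, dot t t < r -> u y + dot g t + dot (t *m H) t / 2 <= u (y + t)) ->
    Pu H) ->
  (forall y z g H r, D y -> Di z -> u y - v z < 1 -> H^T = H -> 0 < r ->
    (forall t, dot t t < r -> v (z + t) <= v z + dot g t + dot (t *m H) t / 2) ->
    Pv H) -> False.
Proof.
move=> cD Db DiD oDi lu lv bd ub uM vM DB K0 gap hu hv.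
have M0 : 0 <= M by rewrite (le_trans _ (uM b Db)).
have B0 : 0 <= B by rewrite (le_trans _ (DB b Db))// dot_ge0.
have D0 : D !=set0 by exists b.
have [c [rho [delta [c1 rho0 delta0 loc]]]] :=
  near_minimizers_interior cD oDi lu lv bd uM vM DB M0 B0.
have c0 : 0 < c by exact: lt_le_trans c1.
pose uu := upper_env u D c; pose ll := lower_env v D c; pose ww := middle_env v D c.
pose f t := uu t - ll t.
have vM' x : D x -> `|- v x| <= M by rewrite normrN; exact: vM.
have lbu := bounded_conv_lb (ltW c0) uM.
have lbv := bounded_conv_lb (ltW c0) vM'.
have loc2 (p x y z : E) e : (forall i, `|p 0 i| <= rho) -> D y -> D z ->
    u y + c * dot (x - y) (x - y) <= uu x + e ->
    - v z + c * dot (x - z) (x - z) <= - ll x + e ->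
    f x - dot p (x - b) + 2 * e <= delta ->
    [/\ Di y, Di z, u y - v z < 1 & dot (x - b) (x - b) <= 4 * (1 + 2 * M) + 2 * B].
  move=> hp Dy Dz h1 h2 h3; apply: (loc p) => //.
  by move: h1 h2 h3; rewrite /f; clear; lra.
(* The budget of [near_min]: four errors [e] and one [c * r ^+ 2], each at most [delta / 5]. *)
have d50 : 0 < delta / 5 by rewrite divr_gt0.
have fb : f b <= 0.
  have := gap_le c1 uM vM b Db Db; rewrite -/uu -/ll -/(f b) subrr dot0l.
  by clear -ub; lra.
(* With [gam = K / 64], the errors of [close] at two points and [e] total at most [3 K r^2 / 64],
   below the height [K r^2 / 8] of the bump on the sphere of radius [r / 2]. *)
have [||p [xp [a [e [r [hp r0 cr [e0 ed er a_le [xp_e [cq [g [H [Hs close]]]]]]]]]]]] :=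
    @contact_near_quadratic R n f ww b c rho (delta / 5) (K / 64)
      (4 * (1 + 2 * M) + 2 * B) c1 rho0 d50 (divr_gt0 K0 (ltr0n R 64))
      _ (middle_two_sided c0 D0 vM) fb (fun (p : E) e => gap_inf c1 Db uM vM p DB (e := e))
      (fun (x y p q : E) e => contact_separation c0 D0 uM vM
        (x := x) (y := y) (p := p) (q := q) (e := e)).
- by rewrite !(mulr_ge0, addr_ge0).
- move=> p x hp h.
  have [y Dy hy] := infconv_near x lbu D0 d50.
  have [z Dz hz] := infconv_near x lbv D0 d50.
  have [] := loc2 p x y z (delta / 5) hp Dy Dz (ltW hy) => //.
    by apply/ltW; rewrite /ll /lower_env opprK.
  by move: h delta0; clear; lra.
have wu x : ww x <= uu x - dot p x - a.
  apply: (middle_le_upper c0 D0 uM vM) => y.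
  by have := a_le y; rewrite /f /uu /ll; clear; lra.
have lw x : ll x <= ww x := lower_le_middle c0 D0 vM x.
have near_min x : dot (x - xp) (x - xp) < (r / 2) ^+ 2 ->
    f x - dot p (x - b) + 2 * e <= delta.
  move=> hx; have := gap_semiconcave c0 D0 uM vM xp x; rewrite /= -/uu -/ll -!/(f _) => h1.
  have h2 := a_le (xp *+ 2 - x).
  have e5 : dot p (xp *+ 2 - x) = 2 * dot p xp - dot p x.
    by rewrite [xp *+ 2]mulr2n !dotE; ring.
  have h3 : 4 * c * dot (x - xp) (x - xp) <= c * r ^+ 2.
    have -> : c * r ^+ 2 = 4 * c * (r / 2) ^+ 2 by field.
    by rewrite ler_pM2l ?mulr_gt0// ltW.
  have h4 := a_le b; rewrite e5 in h2; rewrite dotDr dotNr.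
  by clear -h1 h2 h3 h4 cr ed xp_e fb; lra.
have Kr : 0 < K * r ^+ 2 by rewrite mulr_gt0// exprn_gt0.
have r20 : 0 < r / 2 by rewrite divr_gt0.
have c_xp := close xp; rewrite subrr dot0l sqr_ge0 in c_xp.
have {c_xp}/ler_normlP[cx1 cx2] := c_xp isT.
have Ksq : K / 2 * (r / 2) ^+ 2 = K * r ^+ 2 / 8 by field.
apply: (gap H Hs).
- have [c' [g' qE]] := quad_bump cq g H 0 xp K.
  have HKs : (H + K%:M)^T = H + K%:M by rewrite raddfD/= Hs tr_scalar_mx.
  pose Q y := - quad c' g' (H + K%:M) y.
  have QE y : Q y = - quad cq g H y - K / 2 * dot (y - xp) (y - xp).
    by rewrite /Q -qE dot0l; ring.
  have cQ : continuous Q by move=> y; apply: continuousN; exact: continuous_quad.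
  have [|x1 [y1 [hx1 Dy1 m1 [r1 r10 m2]]]] :=
    infconv_touch (x0 := xp) (s := r / 2) D0 cD lv lbv cQ r20.
    move=> x hx; rewrite !QE hx Ksq subrr dot0l.
    have /close/ler_normlP[h1 h2] : dot (x - xp) (x - xp) <= (r / 2) ^+ 2 by rewrite hx.
    have h3 := wu xp; have h4 := lw x.
    rewrite -[infconv _ _ _ xp]opprK -[infconv _ _ _ x]opprK.
    rewrite -/(lower_env v D c xp) -/(lower_env v D c x) -/(ll _) -/(ll _).
    rewrite /f in xp_e.
    by clear -h1 h2 h3 h4 xp_e er Kr cx1 cx2; lra.
  (* A near-optimal point for [u] at the same [x1] supplies the pair from which [loc2] places [y1]
     in [Di]. *)
  have [z Dz hz] := infconv_near x1 lbu D0 e0.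
  have m1' : - v y1 + c * dot (x1 - y1) (x1 - y1) <= - ll x1 + e.
    by apply: le_trans m1 _; rewrite /ll /lower_env opprK lerDl ltW.
  have [_ Diy1 uv1 _] := loc2 p x1 z y1 e hp Dz Dy1 (ltW hz) m1' (near_min x1 hx1).
  have /nbhs_dotP[r2 r20' hr2] := oDi y1 Diy1.
  apply: (hv z y1 (g' + x1 *m (H + K%:M)) (H + K%:M) (Num.min r1 r2)) => //.
    by rewrite lt_min r10.
  move=> t; rewrite lt_min => /andP[t1 t2].
  have Dt : D (y1 + t) by apply: DiD; apply: hr2; rewrite addrC addKr.
  have := m2 t t1 Dt; rewrite /Q quadD//.
  by clear; lra.
(* The slope [p] enters on this side, because [w] lies below [uu - p.x - a]. *)
- have [c' [g' qE]] := quad_bump cq g H p xp (- K).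
  rewrite (_ : H - K%:M = H + (- K)%:M); last by rewrite raddfN.
  have HKs : (H + (- K)%:M)^T = H + (- K)%:M by rewrite raddfD/= Hs tr_scalar_mx.
  pose Q y := quad c' g' (H + (- K)%:M) y.
  have QE y : Q y = quad cq g H y + dot p y - K / 2 * dot (y - xp) (y - xp).
    by rewrite /Q -qE; ring.
  have cQ : continuous Q by exact: continuous_quad.
  have [|x1 [y1 [hx1 Dy1 m1 [r1 r10 m2]]]] :=
    infconv_touch (x0 := xp) (s := r / 2) D0 cD lu lbu cQ r20.
    move=> x hx; rewrite !QE hx Ksq subrr dot0l.
    have /close/ler_normlP[h1 h2] : dot (x - xp) (x - xp) <= (r / 2) ^+ 2 by rewrite hx.
    have h3 := wu x; have h4 := lw xp.
    rewrite -/(upper_env u D c xp) -/(upper_env u D c x) -/(uu _) -/(uu _).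
    rewrite /f in xp_e.
    by clear -h1 h2 h3 h4 xp_e er Kr cx1 cx2; lra.
  have [z Dz hz] := infconv_near x1 lbv D0 e0.
  have m1' : u y1 + c * dot (x1 - y1) (x1 - y1) <= uu x1 + e.
    by apply: le_trans m1 _; rewrite lerDl ltW.
  have hz' : - v z + c * dot (x1 - z) (x1 - z) <= - ll x1 + e.
    by apply/ltW; rewrite /ll /lower_env opprK.
  have [Diy1 _ uv1 _] := loc2 p x1 y1 z e hp Dy1 Dz m1' hz' (near_min x1 hx1).
  have /nbhs_dotP[r2 r20' hr2] := oDi y1 Diy1.
  apply: (hu y1 z (g' + x1 *m (H + (- K)%:M)) (H + (- K)%:M) (Num.min r1 r2)) => //.
    by rewrite lt_min r10.
  move=> t; rewrite lt_min => /andP[t1 t2].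
  have Dt : D (y1 + t) by apply: DiD; apply: hr2; rewrite addrC addKr.
  have := m2 t t1 Dt; rewrite /Q quadD//.
  by clear; lra.
Qed.

End Key.

(** * Viscosity solutions *)

Section TestFunctions.
Variables (R : realType) (n : nat).
Notation E := 'rV[R]_n.
Implicit Types (x y g t : E) (H : 'M[R]_n).

Lemma derive_quadratic_along (f : E -> R) x (d : E) (A B : R) :
  (forall h, f (x + h *: d) = f x + h * A + h ^+ 2 * B) ->
  derivable f x d /\ 'D_d f x = A.
Proof.
move=> fE.
have h : h^-1 *: ((f \o shift x) (h *: d) - f x) @[h --> (0 : R)^'] --> A.
  have h0 : h @[h --> (0 : R)^'] --> (0 : R) by move=> S /nbhs_dnbhs.
  have : A + h * B @[h --> (0 : R)^'] --> A + 0 * B.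
    by refine (cvgD (cvg_cst A) (cvgM h0 (cvg_cst B))).
  rewrite mul0r addr0.
  apply: cvg_trans; apply: near_eq_cvg.
  near=> k.
  have k0 : k != 0 by near: k; exact: nbhs_dnbhs_neq.
  by rewrite /= (addrC _ x) fE /GRing.scale/=; field.
split; first by apply/cvg_ex; exists A.
exact: cvg_lim h.
Unshelve. all: by end_near. Qed.

Lemma derive_affine_along (f : E -> R) x (d : E) (A : R) :
  (forall h, f (x + h *: d) = f x + h * A) -> derivable f x d /\ 'D_d f x = A.
Proof.
by move=> fE; apply: (@derive_quadratic_along f x d A 0) => h; rewrite mulr0 addr0 fE.
Qed.

Lemma partial_quad c g H i : H^T = H ->
  partial_derive i (quad c g H) = fun x => (g + x *m H) 0 i.
Proof.
move=> sH; apply/funext => x.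
have [] // := @derive_quadratic_along (quad c g H) x (delta_mx 0 i) ((g + x *m H) 0 i)
  (dot (delta_mx 0 i *m H) (delta_mx 0 i) / 2).
by move=> h; rewrite quadD// -scalemxAl !dotZr !dotZl dot_delta; field.
Qed.

Lemma partial_grad g H i j :
  (forall x, derivable (fun x : E => (g + x *m H) 0 i) x (delta_mx 0 j)) /\
  partial_derive j (fun x : E => (g + x *m H) 0 i) = fun=> H j i.
Proof.
have h x : derivable (fun x : E => (g + x *m H) 0 i) x (delta_mx 0 j) /\
   'D_(delta_mx 0 j) (fun x : E => (g + x *m H) 0 i) x = H j i.
  apply: derive_affine_along => k.
  by rewrite mulmxDl -scalemxAl -rowE !mxE; ring.
split=> [x|]; first by have [] := h x.
by apply/funext => x; have [] := h x.
Qed.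

Lemma quad_C2 c g H x : H^T = H ->
  C2_near x (quad c g H) /\ hessian (quad c g H) x = H.
Proof.
move=> sH; split; last first.
  apply/matrixP => i j; rewrite mxE partial_quad// (partial_grad g H i j).2.
  by rewrite -[in RHS]sH mxE.
apply/nbhs_dotP; exists 1 => // y _ i j.
rewrite partial_quad// (partial_grad g H i j).2; split.
- have [] // := @derive_quadratic_along (quad c g H) y (delta_mx 0 i) ((g + y *m H) 0 i)
    (dot (delta_mx 0 i *m H) (delta_mx 0 i) / 2).
  by move=> h; rewrite quadD// -scalemxAl !dotZr !dotZl dot_delta; field.
- have -> : (fun x : E => (g + x *m H) 0 i) = fun x => g 0 i + dot x (col i H)^T.
    apply/funext => x'; rewrite !mxE; congr (_ + _); apply: eq_bigr => k _.
    by rewrite !mxE.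
  have cd : continuous (fun x : E => dot x (col i H)^T).
    by apply: continuous_dot ; [move=> x'; exact: cvg_id|exact: cst_continuous].
  by refine (cvgD (cvg_cst (g 0 i)) (cd y)).
- exact: (partial_grad g H i j).1.
- exact: cst_continuous.
Qed.

End TestFunctions.

Section Truncation.
Variable R : realType.
Implicit Types (w : \bar R) (M a : R).

(** Truncation makes values real without affecting those below [M]. As [fine] sends [-oo] to [0],
    the lemmas about it assume [-oo < w]. *)
Definition truncate M w : R := fine (mine w M%:E).

Lemma truncate_le M w : (-oo < w)%E -> ((truncate M w)%:E <= w)%E.
Proof.
rewrite /truncate; case: w => [r _|_|]; [|by rewrite leey|by rewrite ltxx].
by rewrite -EFin_min lee_fin ge_min lexx.
Qed.

Lemma truncate_leM M w : (-oo < w)%E -> truncate M w <= M.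
Proof.
rewrite /truncate; case: w => [r _|_|]; last by rewrite ltxx.
  by rewrite -EFin_min /= ge_min lexx orbT.
by rewrite min_r ?leey.
Qed.

Lemma truncate_id M w : (-oo < w)%E -> truncate M w < M -> w = (truncate M w)%:E.
Proof.
rewrite /truncate; case: w => [r _|_|]; last by rewrite ltxx.
  by rewrite -EFin_min /= gt_min ltxx orbF => /ltW h; rewrite min_l.
by rewrite min_r ?leey//= ltxx.
Qed.

Lemma lt_truncate M w a : (-oo < w)%E -> (a < truncate M w) = (a%:E < w)%E && (a < M).
Proof.
rewrite /truncate; case: w => [r _|_|]; last by rewrite ltxx.
  by rewrite -EFin_min /= lt_min lte_fin.
by rewrite min_r ?leey// ltry.
Qed.

End Truncation.

(** * No strict touching on a small ball *)

Section Local.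
Variables (R : realType) (n : nat).
Notation E := 'rV[R]_n.
Implicit Types (x y z b g t : E) (H X : 'M[R]_n) (Omega D : set E).

Lemma quad_taylor (a : R) g H y : H^T = H -> exists c g', forall t,
  quad c g' H (y + t) = a + dot g t + dot (t *m H) t / 2.
Proof.
move=> sH; exists (a - dot (g - y *m H) y - dot (y *m H) y / 2), (g - y *m H) => t.
by rewrite quadD// subrK /quad; ring.
Qed.

Lemma supersolution_quad (F : 'M[R]_n -> R) Omega (u : E -> \bar R) y (a : R) g H (r : R) :
  viscosity_supersolution F Omega u -> Omega y -> u y = a%:E -> H^T = H -> 0 < r ->
  (forall t, dot t t < r ->
    ((a + dot g t + dot (t *m H) t / 2)%R%:E <= u (y + t)%R)%E) ->
  F H <= 0.
Proof.
move=> [_ _ _ test] Oy uy sH r0 below.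
have [c [g' qE]] := quad_taylor a g y sH.
have [C2 hess] := quad_C2 c g' y sH.
have := test y _ Oy C2; rewrite hess; apply.
  by rewrite uy -[y in LHS]addr0 qE dot0r mul0mx dot0l mul0r !addr0.
apply/nbhs_dotP; exists r => // x xy; have := below _ xy.
by rewrite -qE addrC subrK.
Qed.

Lemma subsolution_quad (F : 'M[R]_n -> R) Omega (v : E -> \bar R) y (a : R) g H (r : R) :
  viscosity_subsolution F Omega v -> Omega y -> v y = a%:E -> H^T = H -> 0 < r ->
  (forall t, dot t t < r ->
    (v (y + t)%R <= (a + dot g t + dot (t *m H) t / 2)%R%:E)%E) ->
  0 <= F H.
Proof.
move=> [_ _ _ test] Oy vy sH r0 above.
have [c [g' qE]] := quad_taylor a g y sH.
have [C2 hess] := quad_C2 c g' y sH.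
have := test y _ Oy C2; rewrite hess; apply.
  by rewrite vy -[y in LHS]addr0 qE dot0r mul0mx dot0l mul0r !addr0.
apply/nbhs_dotP; exists r => // x xy; have := above _ xy.
by rewrite -qE addrC subrK.
Qed.

Lemma lsc_truncate Omega D (u : E -> \bar R) (M : R) :
  D `<=` Omega -> (forall x, Omega x -> (-oo < u x)%E) ->
  @lower_semicontinuous (subspace Omega) R u ->
  lsc_on D (fun x => truncate M (u x)).
Proof.
move=> DO uO lu x a Dx; rewrite lt_truncate; last exact/uO/DO.
move=> /andP[ax aM]; have [V] := lu x a ax.
rewrite -[nbhs _ _]/(nbhs_subspace (x : subspace Omega) V).
rewrite -nbhs_subspace_in; last exact: DO.
move=> xV Va; have {}xV : \forall y \near x, Omega y -> V y by exact: xV.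
near=> y => Dy; have Oy := DO y Dy.
rewrite lt_truncate ?uO// aM andbT; apply: Va.
by move: Oy; near: y.
Unshelve. all: by end_near. Qed.

Lemma lsc_continuous_sub D (f h : E -> R) : lsc_on D f -> continuous h ->
  lsc_on D (fun x => f x - h x).
Proof.
move=> lf ch x a Dx ax; pose e := (f x - h x - a) / 2.
have e0 : 0 < e by rewrite divr_gt0// subr_gt0.
have h1 := lf x (f x - e) Dx; rewrite ltrBlDr ltrDl in h1.
have {}h1 := h1 e0.
have h2 : \forall y \near x, h y < h x + e.
  by apply: (cvgr_lt (h x) (ch x)); rewrite ltrDl.
near=> y => Dy.
have p1 : f x - e < f y by (have : D y by []); near: y.
have p2 : h y < h x + e by near: y.
by rewrite /e in p1 p2; lra.
Unshelve. all: by end_near. Qed.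

Lemma continuous_bounded_on D (h : E -> R) : D !=set0 -> compact D -> continuous h ->
  exists2 B : R, 0 <= B & forall x, D x -> `|h x| <= B.
Proof.
move=> D0 cD ch.
have l0 : lsc_on D (fun=> 0 : R) by move=> x a Dx a0; apply/nbhs_dotP; exists 1.
have ch' : continuous (fun x => `|h x|).
  by move=> x; exact: (cvg_norm (ch x)).
have [x Dx hx] := lsc_compact_min D0 cD (lsc_continuous_sub l0 ch').
by exists `|h x| => // y Dy; have := hx y Dy; rewrite !sub0r lerN2.
Qed.

Lemma lemx_scalar (k : R) : 0 <= k -> lemx 0 (k%:M : 'M[R]_n).
Proof.
move=> k0 xi; rewrite mulmx0 mul0mx mxE mul_mx_scalar -scalemxAl mxE mxE.
by rewrite mulr_ge0// sumr_ge0// => i _; rewrite mxE -expr2 sqr_ge0.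
Qed.

Lemma elliptic_scalar (F : 'M[R]_n -> R) (lam Lam k : R) X :
  (forall X A : 'M[R]_n, X \is symmetricmx -> A \is symmetricmx -> lemx 0 A ->
    lam * \tr A <= F (X + A) - F X <= Lam * \tr A) ->
  X^T = X -> 0 <= k -> F (X + k%:M) <= F X + Lam * n%:R * k.
Proof.
move=> ell sX k0.
have := ell X k%:M; rewrite mxtrace_scalar => /(_ _ _ _)/andP[].
- exact/symmetricmxP.
- by apply/symmetricmxP; rewrite tr_scalar_mx.
- exact: lemx_scalar.
by rewrite -mulr_natl; lra.
Qed.

(** For small [k], [u - k h] lies strictly above [v] on the sphere: where [h < 0] since [u >= v],
    and where [h >= 0] since [u - v] has a positive lower bound there. So [touching_contradiction]
    applies to the truncations. *)
Lemma no_strict_touching (F : 'M[R]_n -> R) (lam Lam : R) Omega (u v : E -> \bar R)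
    b (s : R) c g Hh (theta : R) :
  0 <= Lam ->
  (forall X A : 'M[R]_n, X \is symmetricmx -> A \is symmetricmx -> lemx 0 A ->
    lam * \tr A <= F (X + A) - F X <= Lam * \tr A) ->
  viscosity_supersolution F Omega u -> viscosity_subsolution F Omega v ->
  0 < s -> dball b s `<=` Omega -> (forall x, Omega x -> (v x <= u x)%E) ->
  u b = v b -> Hh^T = Hh -> quad c g Hh b = 0 -> 0 < theta ->
  (forall k X, 0 < k -> X^T = X -> F X + k * theta <= F (X + k *: Hh)) ->
  (forall x, dot (x - b) (x - b) = s ^+ 2 -> 0 <= quad c g Hh x -> (v x < u x)%E) ->
  False.
Proof.
move=> Lam0 ell hu hv s0 DO vu uvb sHh hb theta0 gapF bdry.
have [uO lu _ _] := hu; have [vO lv _ _] := hv.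
pose D := dball b s; pose h := quad c g Hh.
have cD : compact D := @compact_dball R n b s.
have Db : D b by rewrite /D/dball/= subrr dot0l sqr_ge0.
have D0 : D !=set0 by exists b.
have nvO x : Omega x -> (-oo < - v x)%E by move=> /vO vx; rewrite lteNr.
have lnv : @lower_semicontinuous (subspace Omega) R (fun x => - v x)%E.
  move=> x a; rewrite lteNr -EFinN => /lv[V xV Va]; exists V => // y Vy.
  by rewrite lteNr -EFinN; exact: Va.
have lower (w : E -> \bar R) : (forall x, Omega x -> (-oo < w x)%E) ->
    @lower_semicontinuous (subspace Omega) R w ->
    exists2 m : R, 0 <= m & forall x, D x -> ((- m)%:E < w x)%E.
  move=> wO lw; have [x Dx wx] := lsc_compact_min D0 cD (lsc_truncate (M := 0) DO wO lw).
  exists (1 - truncate 0 (w x)).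
    by have := truncate_leM 0 (wO x (DO x Dx)); lra.
  move=> y Dy; apply: lt_le_trans (truncate_le 0 (wO y (DO y Dy))).
  by rewrite lte_fin; have := wx y Dy; lra.
have [mu mu0 umu] := lower u uO lu.
have [mv mv0 vmv] := lower _ nvO lnv.
(* At the touching points [u'' - v' < 1] and [|k h| <= 1], so [u'] and [- v'] stay below [M1 + 2]
   and the truncation is inactive. *)
pose M1 := mu + mv; pose M := M1 + 3.
have M10 : 0 <= M1 by rewrite addr_ge0.
pose u' x := truncate M (u x); pose v' x := - truncate M (- v x)%E.
have uD x : D x -> (-oo < u x)%E by move=> /DO/uO.
have vD x : D x -> (-oo < - v x)%E by move=> /DO/nvO.
have u'l x : D x -> - M1 < u' x.
  move=> Dx; rewrite lt_truncate ?uD//; apply/andP; split.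
    by apply: le_lt_trans (umu x Dx); rewrite lee_fin lerN2 lerDl.
  by rewrite /M; clear -M10; lra.
have v'u x : D x -> v' x < M1.
  move=> Dx; rewrite ltrNl lt_truncate ?vD//; apply/andP; split.
    by apply: le_lt_trans (vmv x Dx); rewrite lee_fin lerN2 lerDr.
  by rewrite /M; clear -M10; lra.
have u'u x : D x -> u' x <= M by move=> Dx; apply/truncate_leM/uD.
have v'l x : D x -> - M <= v' x by move=> Dx; rewrite lerN2; apply/truncate_leM/vD.
have u'E x : D x -> u' x < M -> u x = (u' x)%:E by move=> Dx; apply/truncate_id/uD.
have v'E x : D x -> - M < v' x -> v x = (v' x)%:E.
  move=> Dx; rewrite ltrN2 => /(truncate_id (vD x Dx)) hv2.
  by rewrite /v' EFinN -hv2 oppeK.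
have u'le x : D x -> ((u' x)%:E <= u x)%E by move=> Dx; apply/truncate_le/uD.
have v'ge x : D x -> (v x <= (v' x)%:E)%E.
  by move=> Dx; rewrite /v' EFinN leeNr; apply/truncate_le/vD.
have both x : D x -> u' x <= v' x -> u x = (u' x)%:E /\ v x = (v' x)%:E.
  move=> Dx uv'; have h1 := u'l x Dx; have h2 := v'u x Dx.
  by split; [apply: u'E|apply: v'E] => //; rewrite /M; clear -uv' h1 h2; lra.
have lt' x : D x -> (v x < u x)%E -> v' x < u' x.
  move=> Dx uv; rewrite ltNge; apply/negP => uv'.
  have [h1 h2] := both x Dx uv'; move: uv; rewrite h1 h2 lte_fin.
  by rewrite ltNge uv'.
have le' x : D x -> v' x <= u' x.
  move=> Dx; rewrite leNgt; apply/negP => uv'.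
  have [h1 h2] := both x Dx (ltW uv'); have := vu x (DO x Dx).
  by rewrite h1 h2 lee_fin leNgt uv'.
have lu' : lsc_on D u' := lsc_truncate (M := M) DO uO lu.
have lv' : lsc_on D (fun x => - v' x).
  have -> : (fun x => - v' x) = fun x => truncate M (- v x)%E.
    by apply/funext => x; rewrite opprK.
  exact: lsc_truncate DO nvO lnv.
have ch : continuous h := @continuous_quad R n c g Hh.
have [Bh Bh0 hB] := continuous_bounded_on D0 cD ch.
have [m m0 hm] : exists2 m : R, 0 < m & forall x, dot (x - b) (x - b) = s ^+ 2 ->
    0 <= h x -> m <= u' x - v' x.
  pose S := D `&` [set x | s ^+ 2 <= dot (x - b) (x - b)] `&` [set x | 0 <= h x].
  have cs : continuous (fun x : E => x - b).
    by move=> y; apply: continuousB; [exact: cvg_id|exact: cst_continuous].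
  have cS : compact S.
    apply: compact_closedI; first apply: compact_closedI => //.
      apply: (@closed_comp _ _ (fun x => dot (x - b) (x - b)) [set t | s ^+ 2 <= t]).
        by move=> x _; exact: (continuous_dot cs cs).
      exact: closed_ge.
    apply: (@closed_comp _ _ h [set t | 0 <= t]); last exact: closed_ge.
    by move=> x _; exact: ch.
  have SD x : S x -> D x by move=> [[]].
  have Sx x : dot (x - b) (x - b) = s ^+ 2 -> 0 <= h x -> S x.
    by move=> xs hx; split=> //; split; rewrite /D/dball/= xs.
  have [[x0 Sx0]|noS] := pselect (S !=set0); last first.
    by exists 1 => // x xs hx; exfalso; apply: noS; exists x; exact: Sx.
  have lS : forall x a, S x -> a < u' x - v' x ->
      \forall y \near x, S y -> a < u' y - v' y.
    move=> x a xS ax; pose e := (u' x - v' x - a) / 2.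
    have e0 : 0 < e by rewrite divr_gt0// subr_gt0.
    have h1 := lu' x (u' x - e) (SD x xS); have h2 := lv' x (- v' x - e) (SD x xS).
    rewrite !ltrBlDr !ltrDl in h1 h2; have {}h1 := h1 e0; have {}h2 := h2 e0.
    near=> y => yS; have Dy := SD y yS.
    have p1 : u' x - e < u' y by move: Dy; near: y.
    have p2 : - v' x - e < - v' y by move: Dy; near: y.
    by rewrite /e in p1 p2; clear -p1 p2; lra.
  have [x xS hx] := lsc_compact_min (ex_intro _ x0 Sx0) cS lS.
  exists (u' x - v' x); last by move=> y ys hy; apply/hx/Sx.
  rewrite subr_gt0; apply: lt'; first exact: SD.
  apply: bdry; last by case: xS.
  by case: xS => [[/= h1 h2] _]; apply/eqP; rewrite eq_le h1 h2.
have [k [k0 kh1 khm]] : exists k : R, [/\ 0 < k, k * Bh <= 1 & k * Bh < m].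
  have B1 : 0 < Bh + 1 by rewrite ltr_wpDl.
  exists (Num.min 1 m / (Bh + 1)); split.
  - by rewrite divr_gt0// lt_min ltr01.
  - rewrite mulrAC ler_pdivrMr// mul1r.
    apply: (@le_trans _ _ (1 * Bh)); first by rewrite ler_wpM2r// ge_min lexx.
    by rewrite mul1r lerDl.
  - rewrite mulrAC ltr_pdivrMr//.
    apply: (@le_lt_trans _ _ (m * Bh)); first by rewrite ler_wpM2r// ge_min lexx orbT.
    by rewrite ltr_pM2l// ltrDl.
have khB x : D x -> `|k * h x| <= k * Bh.
  by move=> Dx; rewrite normrM gtr0_norm// ler_pM2l// hB.
pose u'' x := u' x - k * h x.
pose Di : set E := [set x | dot (x - b) (x - b) < s ^+ 2].
have DiD x : Di x -> D x by move=> /ltW.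
have oDi x : Di x -> \forall y \near x, Di y.
  have cs : continuous (fun x : E => x - b).
    by move=> y; apply: continuousB; [exact: cvg_id|exact: cst_continuous].
  by move=> hx; apply: (cvgr_lt (dot (x - b) (x - b)) (continuous_dot cs cs (x := x))).
have lu'' : lsc_on D u''.
  apply: lsc_continuous_sub => // x.
  by refine (cvgM (cvg_cst k) (ch x)).
(* Bending by [K] costs at most [Lam n K] in each of the two inequalities, together less than the
   gain [k * theta]. *)
pose K := k * theta / (2 * (Lam * n%:R) + 1).
have Ln0 : 0 <= Lam * n%:R by rewrite mulr_ge0.
have d0 : 0 < 2 * (Lam * n%:R) + 1 by rewrite ltr_wpDl// mulr_ge0.
have K0 : 0 < K by rewrite divr_gt0// mulr_gt0.
have Ksmall : 2 * (Lam * n%:R * K) < k * theta.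
  have -> : 2 * (Lam * n%:R * K) =
      k * theta * (2 * (Lam * n%:R)) / (2 * (Lam * n%:R) + 1) by rewrite /K; ring.
  by rewrite ltr_pdivrMr// ltr_pM2l ?mulr_gt0// ltrDl.
have hD x t : h (x + t) = h x + (dot (g + x *m Hh) t + dot (t *m Hh) t / 2).
  by rewrite /h quadD// addrA.
(* A quadratic with Hessian [H] below [u - k h] becomes, after adding [k h], a test function for [u]
   with Hessian [H + k *: Hh]. *)
apply: (@touching_contradiction R n u'' v' D Di b (M + 1) (s ^+ 2) K
  (fun H => F (H + k *: Hh) <= 0) (fun H => 0 <= F H)) => //.
- move=> x Dx nDi; have xs : dot (x - b) (x - b) = s ^+ 2.
    by apply/eqP; rewrite eq_le Dx leNgt; apply/negP.
  have /ler_normlP[_ h1] := khB x Dx.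
  have [hx|hx] := leP 0 (h x).
    by have := hm x xs hx; rewrite /u''; clear -h1 khm; lra.
  have h2 := le' x Dx; have h3 : k * h x < 0 by rewrite pmulr_rlt0.
  by rewrite /u''; clear -h2 h3; lra.
- rewrite /u'' /h hb mulr0 subr0 leNgt; apply/negP => lt.
  have := lt; rewrite lt_truncate ?uD// => /andP[+ _].
  by rewrite uvb ltNge v'ge.
- move=> x Dx; have /ler_normlP[h1 h2] := khB x Dx; have h3 := u'l x Dx; have h4 := u'u x Dx.
  by rewrite ler_norml /u'' /M in h4 *; apply/andP; split; clear -h1 h2 h3 h4 kh1 M10; lra.
- move=> x Dx; have h3 := v'u x Dx; have h4 := v'l x Dx.
  by rewrite ler_norml /M in h4 *; apply/andP; split; clear -h3 h4 M10; lra.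
- move=> H sH p1 p2.
  have sK : (K%:M : 'M[R]_n)^T = K%:M by rewrite tr_scalar_mx.
  have e1 := elliptic_scalar ell sH (ltW K0).
  have sH2 : (H - K%:M + k *: Hh)^T = H - K%:M + k *: Hh.
    by rewrite raddfD/= raddfB/= sH sK linearZ/= sHh.
  have e2 := elliptic_scalar ell sH2 (ltW K0).
  have e3 := gapF k H k0 sH.
  rewrite (addrAC (H - K%:M)) subrK in e2.
  by clear -p1 p2 e1 e2 e3 Ksmall; lra.
- move=> y z g0 H r Diy Dz uvlt sH r0 test.
  have Dy := DiD y Diy.
  have uyM : u' y < M.
    have /ler_normlP[_ h1] := khB y Dy; have h2 := v'u z Dz.
    by move: uvlt; rewrite /u'' /M; clear -h1 h2 kh1; lra.
  have /nbhs_dotP[r2 r20 hr2] := oDi y Diy.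
  apply: (@supersolution_quad F Omega u y (u' y) (g0 + k *: (g + y *m Hh)) _
    (Num.min r r2) hu) => //.
  - exact: DO.
  - exact: u'E.
  - by rewrite raddfD/= sH linearZ/= sHh.
  - by rewrite lt_min r0.
  move=> t; rewrite lt_min => /andP[t1 t2].
  have Dt : D (y + t) by apply: DiD; apply: hr2; rewrite addrC addKr.
  apply: le_trans (u'le _ Dt); rewrite lee_fin.
  have := test t t1; rewrite /u'' hD mulmxDr -scalemxAr !dotE.
  by clear; lra.
- move=> y z g0 H r Dy Diz uvlt sH r0 test.
  have Dz := DiD z Diz.
  have vzM : - M < v' z.
    have /ler_normlP[_ h1] := khB y Dy; have h2 := u'l y Dy.
    by move: uvlt; rewrite /u'' /M; clear -h1 h2 kh1; lra.
  have /nbhs_dotP[r2 r20 hr2] := oDi z Diz.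
  apply: (@subsolution_quad F Omega v z (v' z) g0 _ (Num.min r r2) hv) => //.
  - exact: DO.
  - exact: v'E.
  - by rewrite lt_min r0.
  move=> t; rewrite lt_min => /andP[t1 t2].
  have Dt : D (z + t) by apply: DiD; apply: hr2; rewrite addrC addKr.
  by apply: le_trans (v'ge _ Dt) _; rewrite lee_fin; exact: test.
Unshelve. all: by end_near. Qed.

End Local.

Lemma ereal_between (R : realType) (x y : \bar R) :
  (x < y)%E -> exists a : R, (x < a%:E < y)%E.
Proof.
case: x => [r| |]; case: y => [r'| |] //; rewrite ?ltxx// => xy.
- exists ((r + r') / 2); rewrite !lte_fin in xy *.
  by apply/andP; split; lra.
- by exists (r + 1); rewrite ltry andbT lte_fin; lra.
- by exists (r' - 1); rewrite ltNyr lte_fin/=; lra.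
- by exists 0; rewrite ltNyr ltry.
Qed.

(** * The touching ball and the conclusion *)

Section OuterProduct.
Variables (R : realType) (n : nat).
Implicit Types (x y nu : 'rV[R]_n).

Lemma mulmx_outer x nu : x *m (nu^T *m nu) = dot x nu *: nu.
Proof.
rewrite mulmxA [x *m _]mx11_scalar mul_scalar_mx; congr (_ *: _).
by rewrite mxE; apply: eq_bigr => i _; rewrite mxE.
Qed.

Lemma lemx_outer (k : R) nu : 0 <= k -> lemx 0 (k *: (nu^T *m nu)).
Proof.
move=> k0 xi; rewrite mulmx0 mul0mx mxE -scalemxAr -scalemxAl mxE mulr_ge0//.
have -> : xi^T *m (nu^T *m nu) *m xi = (nu *m xi)^T *m (nu *m xi).
  by rewrite trmx_mul !mulmxA.
rewrite mxE big_ord1 mxE -expr2.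
exact: sqr_ge0.
Qed.

Lemma mxtrace_outer nu : \tr (nu^T *m nu) = dot nu nu.
Proof.
rewrite mxtrace_mulC [nu *m _]mx11_scalar mxtrace_scalar mulr1n.
by rewrite mxE; apply: eq_bigr => i _; rewrite mxE.
Qed.

End OuterProduct.

Theorem theorem4p4p3 (R : realType) (n : nat) (hn : (2 <= n)%N)
    (F : 'M[R]_n -> R) (hF : uniformly_elliptic F)
    (Omega : set 'rV[R]_n) (hO : open Omega) (hC : connected Omega)
    (hne : Omega !=set0)
    (u v : 'rV[R]_n -> \bar R)
    (hu : viscosity_supersolution F Omega u)
    (hv : viscosity_subsolution F Omega v)
    (huv : forall x, Omega x -> (v x <= u x)%E)
    (x0 : 'rV[R]_n) (hx0 : Omega x0) (heq : u x0 = v x0) :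
  forall x, Omega x -> u x = v x.
Proof.
have [lam [Lam [lam0 lamLam ell]]] := hF.
have [uO lu _ _] := hu; have [vO lv _ _] := hv.
have Lam0 : 0 < Lam by exact: lt_le_trans lamLam.
pose W := [set x | Omega x /\ (v x < u x)%E].
have oW : open W.
  rewrite openE => x [Ox] /ereal_between[a /andP[va au]].
  have [A] := lu x a au; have [B] := lv x a va.
  rewrite -![nbhs (x : subspace Omega) _]/(nbhs_subspace (x : subspace Omega) _).
  rewrite -nbhs_subspace_in// => xB Ba xA Aa.
  have {}xA : \forall y \near x, Omega y -> A y by exact: xA.
  have {}xB : \forall y \near x, Omega y -> B y by exact: xB.
  have xO : \forall y \near x, Omega y by exact: open_nbhs_nbhs.
  near=> y; have Oy : Omega y by near: y.
  split => //; apply: (@lt_trans _ _ a%:E).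
    by apply: Ba; move: Oy; near: y.
  by apply: Aa; move: Oy; near: y.
have notW x : Omega x -> ~ W x -> u x = v x.
  move=> Ox nW; apply/eqP; rewrite eq_le huv// andbT leNgt.
  by apply/negP => vu; apply: nW.
move=> x1 Ox1; apply: (notW x1) => // Wx1.
pose Z := Omega `&` ~` W.
have ZO z : Z z -> Omega z by case.
have Zx0 : Z x0 by split => // -[_]; rewrite heq ltxx.
(* [Z] is nonempty and relatively closed; were it open, connectedness would give [Z = Omega],
   against [Wx1]. *)
have [z0 [Zz0 nint]] : exists z, Z z /\ ~ nbhs z Z.
  apply: contrapT => /forallNP h.
  have : Z = Omega.
    apply: hC; first by exists x0.
      exists Z; last by rewrite /Z setIA setIid.
      rewrite openE => z Zz; apply: contrapT => nz.
      by apply: (h z); split.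
    by exists (~` W) => //; exact: open_closedC.
  by move=> ZE; have [_ /(_ Wx1)] : Z x1 by rewrite ZE.
have /nbhs_dotP[r0 r00 hr0] : nbhs z0 Omega.
  by apply: open_nbhs_nbhs; split => //; exact: ZO.
have [sg [sg0 sg1]] : exists sg : R, 0 < sg /\ 16 * sg ^+ 2 < r0.
  exists (Num.min 1 (r0 / 32)); split; first by rewrite lt_min ltr01 divr_gt0.
  have m0 : 0 <= Num.min 1 (r0 / 32) by rewrite le_min ler01 ltW// divr_gt0.
  apply: (@le_lt_trans _ _ (16 * (r0 / 32))); last by lra.
  rewrite ler_pM2l// expr2; apply: (@le_trans _ _ (1 * Num.min 1 (r0 / 32))).
    by rewrite ler_wpM2r// ge_min lexx.
  by rewrite mul1r ge_min lexx orbT.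
have sg2 : 0 < sg ^+ 2 by rewrite exprn_gt0.
have [a [az0 nZa]] : exists a, dot (a - z0) (a - z0) < sg ^+ 2 /\ ~ Z a.
  apply: contrapT => /forallNP h; apply: nint; apply/nbhs_dotP.
  by exists (sg ^+ 2) => // y yz; apply: contrapT => nZ; apply: (h y).
(* The nearest point [b] of [S] to [a] is no farther than [z0], so the open ball about [a] through
   [b] stays within [2 * sg] of [z0] and hence in [W]. *)
pose S := dball z0 (2 * sg) `&` ~` W.
have cS : compact S.
  by apply: compact_closedI; [exact: compact_dball|exact: open_closedC].
have ball_Omega x : dot (x - z0) (x - z0) <= 16 * sg ^+ 2 -> Omega x.
  by move=> h; apply: hr0; exact: le_lt_trans sg1.
have SZ x : S x -> Z x.
  move=> [xz nW]; split => //; apply: ball_Omega; move: xz; rewrite /dball/=.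
  by rewrite exprMn (_ : 2 ^+ 2 = 4)//; [lra|ring].
have Sz0 : S z0.
  have [_ nW] := Zz0; split=> //.
  by rewrite /dball/= subrr dot0l sqr_ge0.
have cd : continuous (fun x : 'rV[R]_n => dot (x - a) (x - a)).
  have cs : continuous (fun x : 'rV[R]_n => x - a).
    by move=> y; apply: continuousB; [exact: cvg_id|exact: cst_continuous].
  exact: continuous_dot.
have [b Sb bmin] : exists2 b, S b &
    forall y, S y -> dot (b - a) (b - a) <= dot (y - a) (y - a).
  apply: lsc_compact_min => //; first by exists z0.
  move=> x e Sx ex.
  have h : \forall y \near x, e < dot (y - a) (y - a).
    by apply: (cvgr_gt (dot (x - a) (x - a)) (cd x)).
  by near=> y => _; near: y.
have Zb := SZ b Sb; have Ob := ZO b Zb.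
have [nu nuE] : exists nu, nu = a - b by eexists.
pose V := dot nu nu.
have VE : V = dot (b - a) (b - a) by rewrite /V nuE dot_subC.
have Vs : V < sg ^+ 2.
  by rewrite VE; apply: le_lt_trans (bmin z0 Sz0) _; rewrite dot_subC.
have V0 : 0 < V.
  have [i nui] : exists i, nu 0 i != 0.
    apply: contrapT => /forallNP h; apply: nZa.
    suff -> : a = b by [].
    apply/eqP; rewrite -subr_eq0 -nuE; apply/eqP/rowP => i; rewrite [RHS]mxE.
    by have /negP := h i; rewrite negbK => /eqP.
  by apply: lt_le_trans (coord_le_dot nu i); rewrite exprn_even_gt0.
have inside x : dot (x - a) (x - a) < V -> (v x < u x)%E.
  move=> xa; have xz := dot_sub_le x a z0.
  have Sx : dball z0 (2 * sg) x.
    by rewrite /dball/= exprMn (_ : 2 ^+ 2 = 4); [lra|ring].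
  have [[]//|nW] := pselect (W x).
  by have := bmin x (conj Sx nW); rewrite -VE leNgt xa.
(* Ellipticity gains [2 k (Lam n + 1)] along [nu] and loses at most [2 k Lam n] from [- |y|^2]; the
   net gain is [2 k], whence [theta = 2]. *)
pose C1 := (Lam * n%:R + 1) / (lam * V).
have C10 : 0 < C1 by rewrite divr_gt0 ?mulr_gt0// ltr_wpDl// mulr_ge0// ltW.
pose Hh := (2 * C1) *: (nu^T *m nu) - 2%:M : 'M[R]_n.
have sHh : Hh^T = Hh.
  by rewrite /Hh raddfB/= linearZ/= trmx_mul trmxK tr_scalar_mx.
have [c [g hE]] := quad_taylor 0 nu b sHh.
have dHh t : dot (t *m Hh) t = 2 * C1 * dot nu t ^+ 2 - 2 * dot t t.
  rewrite /Hh mulmxBr -scalemxAr mulmx_outer mul_mx_scalar !dotE (dotC t nu).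
  by ring.
(* For [s ^+ 2 <= k0], Young's inequality gives [|C1 p| <= 1/4 + C1^2 V s^2 <= 1/2] for [p = nu.t]
   on the sphere. *)
pose k0 := (4 * C1 ^+ 2 * V)^-1.
have C2V : 0 < 4 * C1 ^+ 2 * V by rewrite mulr_gt0// mulr_gt0// exprn_gt0.
have k00 : 0 < k0 by rewrite invr_gt0.
have [s [s0 ssg sk]] : exists s : R, [/\ 0 < s, s ^+ 2 <= sg ^+ 2 & s ^+ 2 <= k0].
  exists (Num.min sg (Num.min 1 k0)).
  have m0 : 0 < Num.min sg (Num.min 1 k0) by rewrite !lt_min sg0 ltr01.
  split=> //; first by rewrite lerXn2r ?nnegrE ?(ltW m0) ?(ltW sg0)// ge_min lexx.
  rewrite expr2; apply: (@le_trans _ _ (1 * Num.min sg (Num.min 1 k0))).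
    by rewrite ler_wpM2r ?(ltW m0)// !ge_min lexx orbT.
  by rewrite mul1r !ge_min lexx !orbT.
apply: (@no_strict_touching R n F lam Lam Omega u v b s c g Hh 2 (ltW Lam0)
  ell hu hv s0) => //.
- move=> x xb; apply: ball_Omega; have := dot_sub_le x b z0.
  have [bz _] := Sb; move: xb bz; rewrite /dball/= exprMn (_ : 2 ^+ 2 = 4); last by ring.
  by clear -ssg sg2; lra.
- by apply: notW => //; case: Zb.
- by rewrite -[b in LHS]addr0 hE dot0r mul0mx dot0l mul0r !addr0.
- move=> k X kp sX.
  have s2k : (X - (2 * k)%:M)^T = X - (2 * k)%:M by rewrite raddfB/= sX tr_scalar_mx.
  have kk : 0 <= 2 * k by rewrite mulr_ge0// ltW.
  have e1 := elliptic_scalar ell s2k kk; rewrite subrK in e1.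
  have A0 : 0 <= 2 * k * C1 by rewrite mulr_ge0// ltW.
  have sA : (2 * k * C1) *: (nu^T *m nu) \is symmetricmx.
    by apply/symmetricmxP; rewrite linearZ/= trmx_mul trmxK.
  have := ell (X - (2 * k)%:M) _ _ sA (lemx_outer nu A0).
  have -> : X - (2 * k)%:M + (2 * k * C1) *: (nu^T *m nu) = X + k *: Hh.
    rewrite /Hh scalerBr scalerA -addrA; congr (_ + _).
    by rewrite addrC scale_scalar_mx; congr (_ *: _ - _%:M); ring.
  rewrite linearZ/= mxtrace_outer -/V => /(_ _)/andP[]; first exact/symmetricmxP.
  have -> : lam * (2 * k * C1 * V) = 2 * k * (Lam * n%:R + 1).
    by rewrite /C1; field; rewrite !gt_eqF.
  by move=> e2 _; clear -e1 e2; lra.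
- move=> x; have [t tE] : exists t, t = x - b by eexists.
  have xE : x = b + t by rewrite tE addrC subrK.
  rewrite -tE {1}xE hE dHh; set p := dot nu t => xs hx.
  apply: inside.
  have -> : dot (x - a) (x - a) = dot t t - 2 * p + V.
    have -> : x - a = t - nu by rewrite tE nuE opprB addrA subrK.
    by rewrite !dotE (dotC t nu) -/p -/V; ring.
  have C1V : 0 < 4 * C1 * V by apply: mulr_gt0 => //; exact: mulr_gt0.
  have mu0 : 0 < (4 * C1 * V)^-1 by rewrite invr_gt0.
  have y1 := dot_young nu t mu0; have y2 := dot_young (- nu) t mu0.
  rewrite dotNl dotNl dotNr opprK -/p -/V xs in y2; rewrite -/p -/V xs in y1.
  have e1 : (4 * C1 * V)^-1 * V = (4 * C1)^-1 by field; rewrite !gt_eqF.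
  have e2 : (4 * (4 * C1 * V)^-1)^-1 = C1 * V by field; rewrite !gt_eqF.
  rewrite e1 e2 in y1 y2.
  have e3 : C1 * ((4 * C1)^-1 + C1 * V * s ^+ 2) <= 2^-1.
    have -> : 2^-1 = C1 * ((4 * C1)^-1 + C1 * V * k0) by rewrite /k0; field; rewrite !gt_eqF.
    rewrite ler_pM2l// lerD2l ler_pM2l//; exact: mulr_gt0.
  have q1 : C1 * p <= 2^-1 by apply: le_trans e3; rewrite ler_pM2l.
  have q2 : - (C1 * p) <= 2^-1 by rewrite -mulrN; apply: le_trans e3; rewrite ler_pM2l.
  have T0 : 0 < dot t t by rewrite xs exprn_gt0.
  (* This is [h >= 0]. With [|C1 p| <= 1/2] it forces [p > 0] and [|t|^2 <= 3 p / 2 < 2 p], so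
     [|x - a|^2 = |t|^2 - 2 p + V < V]. *)
  have hx2 : dot t t <= p * (1 + C1 * p).
    by move: hx; rewrite add0r expr2; clear; lra.
  have p0 : 0 < p.
    have : 0 < p * (1 + C1 * p) by exact: lt_le_trans hx2.
    by rewrite pmulr_lgt0//; clear -q2; lra.
  have : p * (1 + C1 * p) <= p * (3 / 2) by rewrite ler_pM2l//; clear -q1; lra.
  by clear -hx2 p0; lra.
Unshelve. all: by end_near. Qed.
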